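(* Let $1\le p\le\infty$ and set $a=\dfrac{1}{2\max\{2,p\}}$ (so $a=0$ if $p=\infty$). Then for every $\varepsilon>0$ there exists an entire function $f$ that is distributionally irregular for the differentiation operator $D$ on $H(\mathbb{C})$ and a constant $C>0$ such that $$M_p(f,r)\le C\,\frac{e^r}{r^{a-\varepsilon}}\quad\text{for all } r>0.$$
   Context: $\mathbb{N}$ is the set of positive integers. For $A\subset\mathbb{N}$, the upper density is $\overline{\mathrm{dens}}(A)=\limsup_{n\to\infty}\frac{\mathrm{card}(A\cap\{1,\dots,n\})}{n}$. $H(\mathbb{C})$ is the Fréchet space of entire functions with the topology of uniform convergence on compact sets, and $D:H(\mathbb{C})\to H(\mathbb{C})$, $Df=f'$. For $m\in\mathbb{N}$, $\overline{B(0,m)}=\{z\in\mathbb{C}:|z|\le m\}$ and $\|g\|_{\infty,\overline{B(0,m)}}=\sup_{|z|\le m}|g(z)|$. An entire function $f$ is distributionally irregular for $D$ if there are $m\in\mathbb{N}$ and sets $A,B\subset\mathbb{N}$ with $\overline{\mathrm{dens}}(A)=\overline{\mathrm{dens}}(B)=1$ such that $D^nf\to0$ in $H(\mathbb{C})$ as $n\to\infty$ with $n\in A$, and $\|D^nf\|_{\infty,\overline{B(0,m)}}\to\infty$ as $n\to\infty$ with $n\in B$. For an entire function $f$ and $r>0$: $M_p(f,r)=\left(\frac1{2\pi}\int_0^{2\pi}|f(re^{it})|^p\,dt\right)^{1/p}$ if $1\le p<\infty$, and $M_\infty(f,r)=\sup_{|z|=r}|f(z)|$. *)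

(* Defs.v *)
From Stdlib Require Import Reals List ClassicalEpsilon.
From Coquelicot Require Import Coquelicot.
Open Scope R_scope.

(** * Upper density *)

Definition card_upto (A : nat -> Prop) (n : nat) : nat :=
  length (filter (fun k => if excluded_middle_informative (A k) then true else false)
                 (seq 1 n)).

(** The term of index [0] is irrelevant for the limit superior. *)
Definition upper_density (A : nat -> Prop) : Rbar :=
  LimSup_seq (fun n => INR (card_upto A n) / INR n).

(** * The space H(C) and the operator D *)

(** Complex differentiability; the structures are those for which [C_derive] is
    characterised by [is_C_derive_unique] and [C_derive_correct]. *)
Definition entire (f : C -> C) : Prop :=
  forall z : C, @ex_derive C_AbsRing C_NormedModule f z.

Definition Dn (n : nat) (f : C -> C) : C -> C := Nat.iter n C_derive f.

Definition compact_C (K : C -> Prop) : Prop :=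
  forall (I : Type) (U : I -> C -> Prop),
    (forall i, @open C_UniformSpace (U i)) ->
    (forall z, K z -> exists i, U i z) ->
    exists l : list I, forall z, K z -> exists i, In i l /\ U i z.

(** Convergence in H(C) of [g n] to [h] as [n] tends to infinity along [A]. *)
Definition converges_HC_along (A : nat -> Prop) (g : nat -> C -> C) (h : C -> C) : Prop :=
  forall K : C -> Prop, compact_C K ->
  forall eps : posreal,
    within A eventually (fun n => forall z, K z -> Cmod (g n z - h z)%C < eps).

(** Valued in [Rbar], so that an unbounded function gets [p_infty]. *)
Definition sup_norm (K : C -> Prop) (g : C -> C) : Rbar :=
  Lub_Rbar (fun y => exists z, K z /\ y = Cmod (g z)).

Definition closed_disc (r : R) : C -> Prop := fun z => Cmod z <= r.

Definition circle (r : R) : C -> Prop := fun z => Cmod z = r.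

Definition tends_to_infinity_along (B : nat -> Prop) (u : nat -> Rbar) : Prop :=
  forall M : R, within B eventually (fun n => Rbar_lt M (u n)).

Definition distributionally_irregular (f : C -> C) : Prop :=
  entire f /\
  exists (m : nat) (A B : nat -> Prop),
    (1 <= m)%nat /\
    (forall n, A n -> (1 <= n)%nat) /\
    (forall n, B n -> (1 <= n)%nat) /\
    upper_density A = 1 /\
    upper_density B = 1 /\
    converges_HC_along A (fun n => Dn n f) (fun _ => 0%C) /\
    tends_to_infinity_along B (fun n => sup_norm (closed_disc (INR m)) (Dn n f)).

(** * Integral means *)

(** [Rpower 0 y] is [1] in the standard library; here [0] to a (positive) power
    is [0]. *)
Definition rpow (x y : R) : R := if Req_dec_T x 0 then 0 else Rpower x y.

(** [(r * cos t, r * sin t)] is r e^(it). The value at [m_infty] is never used. *)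
Definition Mp (p : Rbar) (f : C -> C) (r : R) : Rbar :=
  match p with
  | Finite p =>
      Finite (rpow (1 / (2 * PI) *
                    RInt (fun t => rpow (Cmod (f (r * cos t, r * sin t))) p) 0 (2 * PI))
                   (1 / p))
  | p_infty => sup_norm (circle r) f
  | m_infty => Finite 0
  end.

(** 1 / (2 max {2, p}), with value [0] at infinity. *)
Definition growth_exponent (p : Rbar) : R :=
  match p with
  | Finite p => 1 / (2 * Rmax 2 p)
  | _ => 0
  end.

(* Main.v *)
Require Import Defs.
From Stdlib Require Import Reals Lra Lia List Bool Arith FunctionalExtensionality ClassicalEpsilon.
From Coquelicot Require Import Coquelicot.
Open Scope R_scope.

(** Let [f(z)] be the sum of [k^d z^k / k!] over the [k >= K] lying in the blocks
    [N_i <= k < N_(i+1)] with [i] even, where [N_i = 2^(2^i)], [d = min(eps, 1/2)]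
    and [K >= eps]. On the even blocks [D^n f (0) = n^d] is large; if [f] has no
    term of degree [n <= k < 2n], then [D^n f] is [O(n 2^(-n))] on every disc. As
    [N_(i+1) = N_i^2], both sets of [n] have upper density one.

    For the growth, [k^d <= r^d (1 + k/r)] gives [M_oo(f,r) <= 2 r^d e^r], and
    Parseval together with [r^k / k! <= e^r / sqrt r] gives
    [M_2(f,r)^2 <= 2 r^(2d - 1/2) e^(2r)]. For [p > 2] interpolate between these
    two bounds: the exponent [1/(2p)] comes out exactly. *)

(** * Entire functions as exponential generating functions *)

(** The weight k^d is there only because D^n f (0) has to tend to infinity. It costs a factor r^d,
    which eps absorbs; d <= 1/2 lets one moment estimate treat both the coefficients and their
    squares, of size k^(2d). The saving in M_2 reflects that the mass of the exponential series sits
    on about sqrt r indices, with terms of size e^r / sqrt r: their l^2 norm is about e^r r^(-1/4),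
    whereas their sum is about e^r. In the interpolation only the mean square contributes a gain,
    r^(-1/2), and the p-th root turns it into r^(-1/(2p)). The cut-off K concerns small r: if eps
    exceeds the growth exponent, the required bound tends to 0 with r, so f must vanish at 0 to a
    sufficient order. Squaring N_i makes the ratio of the two ends of a block unbounded, so that for
    any given M the interval [N_i, M N_i] lies in its block once i is large. *)

Lemma Cmod_sqr (z : C) : Cmod z * Cmod z = fst z * fst z + snd z * snd z.
Proof.
  unfold Cmod. rewrite sqrt_sqrt; simpl; nra.
Qed.

Lemma Rabs_fst_le_Cmod (z : C) : Rabs (fst z) <= Cmod z.
Proof.
  apply Rle_trans with (2 := Rmax_Cmod z). apply Rmax_l.
Qed.

Lemma Rabs_snd_le_Cmod (z : C) : Rabs (snd z) <= Cmod z.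
Proof.
  apply Rle_trans with (2 := Rmax_Cmod z). apply Rmax_r.
Qed.

Lemma Cauchy_Schwarz_C (z w : C) : fst z * fst w + snd z * snd w <= Cmod z * Cmod w.
Proof.
  assert (Hz := Cmod_sqr z). assert (Hw := Cmod_sqr w).
  assert (H0 := Cmod_ge_0 z). assert (H1 := Cmod_ge_0 w).
  destruct z as [x y], w as [u v]; simpl in *.
  assert (H2 := Rmult_le_pos _ _ H0 H1).
  apply Rsqr_incr_0_var; [|exact H2].
  unfold Rsqr.
  replace (Cmod (x, y) * Cmod (u, v) * (Cmod (x, y) * Cmod (u, v)))
    with ((Cmod (x, y) * Cmod (x, y)) * (Cmod (u, v) * Cmod (u, v))) by ring.
  (* Lagrange's identity: the squares of the two sides differ by (x v - y u)^2. *)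
  rewrite Hz, Hw. assert (H3 := Rle_0_sqr (x * v - y * u)). unfold Rsqr in H3. lra.
Qed.

(** Coordinatewise summation gives a total function to which the lemmas on real series apply; its
    value is meaningful under [Csummable], that is, absolute convergence. *)
Definition Cseries (u : nat -> C) : C :=
  (Series (fun k => fst (u k)), Series (fun k => snd (u k))).

Definition Csummable (u : nat -> C) : Prop := ex_series (fun k => Cmod (u k)).

Lemma ex_series_le_R (a b : nat -> R) :
  (forall k, Rabs (a k) <= b k) -> ex_series b -> ex_series a.
Proof. intros H Hb. apply (@ex_series_le R_AbsRing R_CompleteNormedModule a b); assumption. Qed.

Lemma Csummable_fst (u : nat -> C) : Csummable u -> ex_series (fun k => fst (u k)).
Proof. apply ex_series_le_R. intros k. apply Rabs_fst_le_Cmod. Qed.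

Lemma Csummable_snd (u : nat -> C) : Csummable u -> ex_series (fun k => snd (u k)).
Proof. apply ex_series_le_R. intros k. apply Rabs_snd_le_Cmod. Qed.

Lemma Csummable_le (u : nat -> C) (b : nat -> R) :
  (forall k, Cmod (u k) <= b k) -> ex_series b -> Csummable u.
Proof.
  intros H Hb. apply ex_series_le_R with (2 := Hb). intros k.
  rewrite Rabs_pos_eq; [apply H | apply Cmod_ge_0].
Qed.

Lemma Csummable_minus (u v : nat -> C) :
  Csummable u -> Csummable v -> Csummable (fun k => u k - v k)%C.
Proof.
  intros Hu Hv. apply Csummable_le with (fun k => Cmod (u k) + Cmod (v k)).
  - intros k. unfold Cminus. apply Rle_trans with (1 := Cmod_triangle _ _).
    rewrite Cmod_opp. apply Rle_refl.
  - exact (ex_series_plus _ _ Hu Hv).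
Qed.

Lemma Csummable_scal (c : C) (u : nat -> C) :
  Csummable u -> Csummable (fun k => c * u k)%C.
Proof.
  intros Hu. apply Csummable_le with (fun k => Cmod c * Cmod (u k)).
  - intros k. rewrite Cmod_mult. apply Rle_refl.
  - exact (ex_series_scal (Cmod c) _ Hu).
Qed.

Lemma Cseries_minus (u v : nat -> C) : Csummable u -> Csummable v ->
  Cseries (fun k => u k - v k)%C = (Cseries u - Cseries v)%C.
Proof.
  intros Hu Hv. unfold Cseries.
  replace (Series (fun k => fst (u k - v k)%C))
    with (Series (fun k => fst (u k)) - Series (fun k => fst (v k))).
  replace (Series (fun k => snd (u k - v k)%C))
    with (Series (fun k => snd (u k)) - Series (fun k => snd (v k))).
  - reflexivity.
  - rewrite <- Series_minus by (apply Csummable_snd; assumption). reflexivity.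
  - rewrite <- Series_minus by (apply Csummable_fst; assumption). reflexivity.
Qed.

Lemma Cseries_scal (c : C) (u : nat -> C) : Csummable u ->
  Cseries (fun k => c * u k)%C = (c * Cseries u)%C.
Proof.
  intros Hu. assert (H1 := Csummable_fst _ Hu). assert (H2 := Csummable_snd _ Hu).
  destruct c as [x y]. unfold Cseries, Cmult. simpl. f_equal.
  - rewrite <- !Series_scal_l. rewrite <- Series_minus; [reflexivity | |].
    + exact (ex_series_scal x _ H1).
    + exact (ex_series_scal y _ H2).
  - rewrite <- !Series_scal_l. rewrite <- Series_plus; [reflexivity | |].
    + exact (ex_series_scal x _ H2).
    + exact (ex_series_scal y _ H1).
Qed.

(* Write [|s|^2] as the sum of the inner products [<s, u_k>], each at most [|s| |u_k|]. *)
Lemma Cmod_Cseries_le (u : nat -> C) : Csummable u ->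
  Cmod (Cseries u) <= Series (fun k => Cmod (u k)).
Proof.
  intros Hu. assert (H1 := Csummable_fst _ Hu). assert (H2 := Csummable_snd _ Hu).
  set (s := Cseries u).
  assert (E1 : ex_series (fun k => fst s * fst (u k))) by exact (ex_series_scal (fst s) _ H1).
  assert (E2 : ex_series (fun k => snd s * snd (u k))) by exact (ex_series_scal (snd s) _ H2).
  assert (H : Cmod s * Cmod s <= Cmod s * Series (fun k => Cmod (u k))).
  { rewrite Cmod_sqr. unfold s at 2 4. unfold Cseries. simpl.
    rewrite <- !Series_scal_l, <- Series_plus by assumption.
    assert (E3 : ex_series (fun k => Cmod s * Cmod (u k)))
      by exact (ex_series_scal (Cmod s) _ Hu).
    apply Rle_trans with (Series (fun k => Rabs (fst s * fst (u k) + snd s * snd (u k)))).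
    - apply Rle_trans with (1 := Rle_abs _). apply Series_Rabs.
      apply ex_series_le_R with (2 := E3). intros k. rewrite Rabs_Rabsolu.
      apply Rabs_le. split.
      (* The lower bound of an inner product is the upper bound for [- s]. *)
      + assert (H := Cauchy_Schwarz_C (- s)%C (u k)). rewrite Cmod_opp in H.
        change (- fst s * fst (u k) + - snd s * snd (u k) <= Cmod s * Cmod (u k)) in H. lra.
      + apply Cauchy_Schwarz_C.
    - apply Series_le with (2 := E3). intros k. split. apply Rabs_pos.
      apply Rabs_le. split.
      + assert (H := Cauchy_Schwarz_C (- s)%C (u k)). rewrite Cmod_opp in H.
        change (- fst s * fst (u k) + - snd s * snd (u k) <= Cmod s * Cmod (u k)) in H. lra.
      + apply Cauchy_Schwarz_C. }
  destruct (Cmod_ge_0 s) as [Hs | Hs].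
  - apply Rmult_le_reg_l with (1 := Hs). exact H.
  - rewrite <- Hs. apply Rle_trans with (Series (fun k => 0 * Cmod (u k))).
    + rewrite Series_scal_l. lra.
    + apply Series_le with (2 := Hu). intros k. assert (Hk := Cmod_ge_0 (u k)). split; lra.
Qed.

Lemma Cseries_ext (u v : nat -> C) : (forall k, u k = v k) -> Cseries u = Cseries v.
Proof. intros H. unfold Cseries. f_equal; apply Series_ext; intros k; rewrite H; reflexivity. Qed.

Lemma Cseries_incr_1 (u : nat -> C) : u 0%nat = 0%C -> Cseries u = Cseries (fun k => u (S k)).
Proof.
  intros H. unfold Cseries. f_equal; apply Series_incr_1_aux; rewrite H; reflexivity.
Qed.

(* [D] acts on exponential generating functions by shifting [a]. *)
Definition egf (a : nat -> R) (z : C) : C :=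
  Cseries (fun k => RtoC (a k / INR (fact k)) * z ^ k)%C.

(** Geometric growth makes the series converge in the whole plane and survives a shift of the
    sequence, hence differentiation. The ratio 2 is a convenient choice. *)
Definition exp_bounded (a : nat -> R) : Prop :=
  exists M, forall k, Rabs (a k) <= M * 2 ^ k.

Lemma INR_fact_pos (k : nat) : 0 < INR (fact k).
Proof. apply lt_0_INR, lt_O_fact. Qed.

Lemma is_series_exp (x : R) : is_series (fun k => x ^ k / INR (fact k)) (exp x).
Proof.
  apply is_series_ext with (2 := is_exp_Reals x).
  intros k. rewrite pow_n_pow. unfold scal; simpl; unfold mult; simpl. unfold Rdiv. ring.
Qed.

Lemma Cmod_egf_term (a : nat -> R) (z : C) (k : nat) :
  Cmod (RtoC (a k / INR (fact k)) * z ^ k)%C = Rabs (a k) * Cmod z ^ k / INR (fact k).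
Proof.
  assert (H := INR_fact_pos k).
  rewrite Cmod_mult, Cmod_R, Cmod_pow. unfold Rdiv.
  rewrite Rabs_mult, (Rabs_pos_eq (/ _)). ring. left. apply Rinv_0_lt_compat, H.
Qed.

Lemma ex_series_egf_abs (a : nat -> R) (x : R) : exp_bounded a -> 0 <= x ->
  ex_series (fun k => Rabs (a k) * x ^ k / INR (fact k)).
Proof.
  intros [M HM] Hx.
  apply ex_series_le_R with (fun k => M * ((2 * x) ^ k / INR (fact k))).
  - intros k. assert (H := INR_fact_pos k). assert (Hp := pow_le x k Hx).
    rewrite Rabs_pos_eq.
    + rewrite Rpow_mult_distr. unfold Rdiv.
      replace (M * (2 ^ k * x ^ k * / INR (fact k))) with (M * 2 ^ k * (x ^ k * / INR (fact k))) by ring.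
      rewrite Rmult_assoc. apply Rmult_le_compat_r; [|apply HM].
      apply Rmult_le_pos; [exact Hp | left; apply Rinv_0_lt_compat, H].
    + apply Rmult_le_pos. apply Rmult_le_pos; [apply Rabs_pos | exact Hp].
      left; apply Rinv_0_lt_compat, H.
  - apply (ex_series_scal M (fun k => (2 * x) ^ k / INR (fact k))). eexists. apply is_series_exp.
Qed.

Lemma Csummable_egf (a : nat -> R) (z : C) : exp_bounded a ->
  Csummable (fun k => RtoC (a k / INR (fact k)) * z ^ k)%C.
Proof.
  intros Ha. apply Csummable_le with (2 := ex_series_egf_abs a (Cmod z) Ha (Cmod_ge_0 z)).
  intros k. rewrite Cmod_egf_term. apply Rle_refl.
Qed.

Lemma Cmod_egf_le (a : nat -> R) (z : C) : exp_bounded a ->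
  Cmod (egf a z) <= Series (fun k => Rabs (a k) * Cmod z ^ k / INR (fact k)).
Proof.
  intros Ha. apply Rle_trans with (1 := Cmod_Cseries_le _ (Csummable_egf a z Ha)).
  right. apply Series_ext. intros k. apply Cmod_egf_term.
Qed.

Lemma exp_bounded_shift (a : nat -> R) (n : nat) :
  exp_bounded a -> exp_bounded (fun k => a (n + k)%nat).
Proof.
  intros [M HM]. exists (M * 2 ^ n). intros k.
  rewrite Rmult_assoc, <- pow_add. apply HM.
Qed.

(** The remainder of order two of z^k is h^2 times a polynomial in z and h with nonnegative
    coefficients, so it is largest when z becomes |z| and h becomes 1. The induction replaces the
    binomial formula: R_(k+1) = (z + h) R_k + h^2 k z^(k-1), and the majorant obeys the same
    recursion at |z| and 1. *)
Lemma Cmod_pow_Taylor2 (z h : C) (k : nat) : Cmod h <= 1 ->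
  Cmod ((z + h) ^ k - z ^ k - h * (INR k * z ^ (pred k)))%C
  <= Cmod h * Cmod h * ((Cmod z + 1) ^ k - Cmod z ^ k - INR k * Cmod z ^ (pred k)).
Proof.
  intros Hh. assert (H0 := Cmod_ge_0 h). assert (H1 := Cmod_ge_0 z).
  induction k as [|k IH].
  - simpl. replace (1 - 1 - h * (0 * 1))%C with (RtoC 0) by ring. rewrite Cmod_0. lra.
  - change (pred (S k)) with k.
    assert (Hz : (INR k * z ^ k = INR k * z ^ pred k * z)%C).
    { destruct k; simpl; ring. }
    assert (Hx : INR k * Cmod z ^ k = INR k * Cmod z ^ pred k * Cmod z).
    { destruct k; simpl; ring. }
    replace ((z + h) ^ S k - z ^ S k - h * (INR (S k) * z ^ k))%C
      with ((z + h) * ((z + h) ^ k - z ^ k - h * (INR k * z ^ pred k))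
            + h * h * (INR k * z ^ pred k))%C.
    2: { rewrite S_INR, RtoC_plus, !Cpow_S.
         replace (h * ((INR k + 1) * z ^ k))%C with (h * (INR k * z ^ k) + h * z ^ k)%C by ring.
         rewrite Hz. ring. }
    replace ((Cmod z + 1) ^ S k - Cmod z ^ S k - INR (S k) * Cmod z ^ k)
      with ((Cmod z + 1) * ((Cmod z + 1) ^ k - Cmod z ^ k - INR k * Cmod z ^ pred k)
            + INR k * Cmod z ^ pred k).
    2: { rewrite S_INR. simpl pow.
         replace ((INR k + 1) * Cmod z ^ k) with (INR k * Cmod z ^ k + Cmod z ^ k) by ring.
         rewrite Hx. ring. }
    apply Rle_trans with (1 := Cmod_triangle _ _).
    rewrite !Cmod_mult, Cmod_R, Cmod_pow, (Rabs_pos_eq (INR k)) by apply pos_INR.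
    assert (H2 : Cmod (z + h) <= Cmod z + 1).
    { apply Rle_trans with (1 := Cmod_triangle _ _). lra. }
    assert (H3 := Cmod_ge_0 ((z + h) ^ k - z ^ k - h * (INR k * z ^ pred k))%C).
    assert (H4 := Cmod_ge_0 (z + h)%C).
    assert (H5 := Rmult_le_compat _ _ _ _ H4 H3 H2 IH).
    lra.
Qed.

Lemma egf_Taylor2 (a : nat -> R) (z : C) : exp_bounded a ->
  exists K, forall h, Cmod h <= 1 ->
    Cmod (egf a (z + h) - egf a z - h * egf (fun k => a (S k)) z)%C <= Cmod h * Cmod h * K.
Proof.
  intros Ha.
  set (x := Cmod z). assert (Hx : 0 <= x) by apply Cmod_ge_0.
  assert (Hex := ex_series_egf_abs a (x + 1) Ha ltac:(lra)).
  exists (Series (fun k => Rabs (a k) * (x + 1) ^ k / INR (fact k))).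
  intros h Hh.
  (* The differentiated terms keep the index of the original series, so that the three series can be
     combined termwise; the term of index 0 vanishes. *)
  set (d := fun k => (RtoC (a k / INR (fact k)) * (INR k * z ^ pred k))%C).
  assert (Hterm : forall k, d (S k) = (RtoC (a (S k) / INR (fact k)) * z ^ k)%C).
  { intros k. unfold d. change (pred (S k)) with k.
    rewrite Cmult_assoc, <- RtoC_mult. f_equal. f_equal.
    change (fact (S k)) with (S k * fact k)%nat. rewrite mult_INR.
    field. split. apply INR_fact_neq_0. apply not_0_INR; lia. }
  assert (Hd : egf (fun k => a (S k)) z = Cseries d).
  { rewrite (Cseries_incr_1 d).
    - apply Cseries_ext. intros k. symmetry. apply Hterm.
    - unfold d. change (INR 0) with 0. rewrite Cmult_0_l, Cmult_0_r. reflexivity. }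
  assert (Sd : Csummable d).
  { apply ex_series_incr_1.
    apply ex_series_ext with (2 := Csummable_egf _ z (exp_bounded_shift a 1 Ha)).
    intros k. rewrite Hterm. reflexivity. }
  assert (S1 := Csummable_egf a (z + h) Ha). assert (S2 := Csummable_egf a z Ha).
  rewrite Hd. unfold egf.
  rewrite <- (Cseries_scal h d Sd), <- Cseries_minus, <- Cseries_minus;
    try assumption; try (apply Csummable_minus; assumption); try (apply Csummable_scal; assumption).
  apply Rle_trans with (1 := Cmod_Cseries_le _
     (Csummable_minus _ _ (Csummable_minus _ _ S1 S2) (Csummable_scal h d Sd))).
  rewrite <- Series_scal_l. apply Series_le.
  2: exact (ex_series_scal (Cmod h * Cmod h) _ Hex).
  intros k. split. apply Cmod_ge_0.
  replace (RtoC (a k / INR (fact k)) * (z + h) ^ k - RtoC (a k / INR (fact k)) * z ^ k - h * d k)%C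
    with (RtoC (a k / INR (fact k)) * ((z + h) ^ k - z ^ k - h * (INR k * z ^ pred k)))%C
    by (unfold d; ring).
  rewrite Cmod_mult, Cmod_R. assert (H := INR_fact_pos k). unfold Rdiv.
  rewrite Rabs_mult, (Rabs_pos_eq (/ _)) by (left; apply Rinv_0_lt_compat, H).
  replace (Cmod h * Cmod h * (Rabs (a k) * (x + 1) ^ k * / INR (fact k)))
    with (Rabs (a k) * / INR (fact k) * (Cmod h * Cmod h * (x + 1) ^ k)) by ring.
  apply Rmult_le_compat_l.
  - apply Rmult_le_pos. apply Rabs_pos. left; apply Rinv_0_lt_compat, H.
  - apply Rle_trans with (1 := Cmod_pow_Taylor2 z h k Hh). fold x.
    apply Rmult_le_compat_l. assert (H0 := Cmod_ge_0 h); nra.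
    assert (H1 := pow_le x k Hx). assert (H2 := pow_le x (pred k) Hx).
    assert (H3 := pos_INR k). nra.
Qed.

Lemma is_derive_egf (a : nat -> R) (z : C) : exp_bounded a ->
  @is_derive C_AbsRing C_NormedModule (egf a) z (egf (fun k => a (S k)) z).
Proof.
  intros Ha. destruct (egf_Taylor2 a z Ha) as [K HK]. split.
  - apply @is_linear_scal_l.
  - intros y Hy. apply (@is_filter_lim_locally_unique C_AbsRing (AbsRing_NormedModule C_AbsRing)) in Hy.
    subst y. intros eps.
    (* The 1 is the range of the Taylor estimate; [Rabs K + 1] is positive whatever the sign of
       [K]. *)
    assert (Hd : 0 < Rmin 1 (eps / (Rabs K + 1))).
    { apply Rmin_pos. lra. apply Rdiv_lt_0_compat. apply cond_pos.
      assert (H := Rabs_pos K). lra. }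
    exists (mkposreal _ Hd). intros y Hy.
    change (Cmod (y - z)%C < Rmin 1 (eps / (Rabs K + 1))) in Hy.
    change (Cmod (egf a y - egf a z - (y - z) * egf (fun k => a (S k)) z)%C <= eps * Cmod (y - z)%C).
    set (h := (y - z)%C) in *.
    replace y with (z + h)%C by (unfold h; ring).
    assert (H1 : Cmod h <= 1). { left. apply Rlt_le_trans with (1 := Hy). apply Rmin_l. }
    assert (H2 : Cmod h <= eps / (Rabs K + 1)). { left. apply Rlt_le_trans with (1 := Hy). apply Rmin_r. }
    apply Rle_trans with (1 := HK h H1).
    assert (H3 := Cmod_ge_0 h). assert (H4 := Rle_abs K). assert (H5 := Rabs_pos K).
    assert (H6 : Cmod h * (Rabs K + 1) <= eps).
    { apply Rmult_le_compat_r with (r := Rabs K + 1) in H2; [|lra].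
      unfold Rdiv in H2. rewrite Rmult_assoc, Rinv_l, Rmult_1_r in H2; lra. }
    rewrite Rmult_assoc, (Rmult_comm (Cmod h)).
    apply Rmult_le_compat_r; nra.
Qed.

Lemma entire_egf (a : nat -> R) : exp_bounded a -> entire (egf a).
Proof. intros Ha z. exists (egf (fun k => a (S k)) z). apply is_derive_egf, Ha. Qed.

Lemma Dn_egf (a : nat -> R) (n : nat) : exp_bounded a ->
  Dn n (egf a) = egf (fun k => a (n + k)%nat).
Proof.
  intros Ha. induction n as [|n IH].
  - reflexivity.
  - unfold Dn in *. simpl Nat.iter. rewrite IH. apply functional_extensionality. intros z.
    rewrite (is_C_derive_unique _ _ _ (is_derive_egf _ z (exp_bounded_shift a n Ha))).
    apply (f_equal (fun b => egf b z)). apply functional_extensionality. intros k.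
    f_equal. lia.
Qed.

Lemma egf_0 (a : nat -> R) : exp_bounded a -> egf a 0 = RtoC (a 0%nat).
Proof.
  intros Ha. assert (Hs := Csummable_egf a 0%C Ha).
  assert (H : forall u : nat -> R, ex_series u -> (forall k, u (S k) = 0) -> Series u = u 0%nat).
  { intros u Hex Hu. rewrite (Series_incr_1 u Hex).
    (* Writing 0 as 0 * 0 lets [Series_scal_l] evaluate the zero series. *)
    rewrite (Series_ext _ (fun _ => 0 * 0)) by (intros k; rewrite Hu; ring).
    rewrite Series_scal_l. ring. }
  unfold egf, Cseries.
  rewrite (H _ (Csummable_fst _ Hs)), (H _ (Csummable_snd _ Hs)).
  - simpl. unfold RtoC. f_equal; field.
  - intros k. simpl. ring.
  - intros k. simpl. ring.
Qed.

(** Differentiability gives continuity for the uniform structure defined by the modulus; [locally_C]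
    transports it to the product structure of [C_UniformSpace], in which the path t -> r e^(it) is
    shown to be continuous. *)
Lemma continuous_egf (a : nat -> R) (z : C) : exp_bounded a ->
  @continuous C_UniformSpace R_UniformSpace (fun w => Cmod (egf a w)) z.
Proof.
  intros Ha.
  assert (H : @continuous (AbsRing_UniformSpace C_AbsRing) C_NormedModule (egf a) z).
  { apply (@ex_derive_continuous C_AbsRing C_NormedModule). exists (egf (fun k => a (S k)) z). apply is_derive_egf, Ha. }
  intros P HP. 
  assert (H1 : @locally C_NormedModule (egf a z) (fun w => P (Cmod w))).
  { apply (@filterlim_norm C_AbsRing C_NormedModule (egf a z) P). exact HP. }
  apply H in H1. unfold filtermap in *. apply locally_C. exact H1.
Qed.

(** * Exponential series and Parseval's inequality *)

Lemma exp_monotone (x y : R) : x <= y -> exp x <= exp y.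
Proof.
  intros [H | H]; [left; apply exp_increasing, H | right; rewrite H; reflexivity].
Qed.

Lemma ln_le_sub_1 (x : R) : 0 < x -> ln x <= x - 1.
Proof.
  intros Hx. rewrite <- (ln_exp (x - 1)). apply ln_le; [exact Hx|].
  assert (H := exp_ineq1_le (x - 1)). lra.
Qed.

(** The difference of the two sides vanishes at 0 and has derivative ln (1 + x) + ln (1 - x) <= x -
    x = 0. This is the concavity estimate for the integral of ln over an interval, rescaled to have
    midpoint 1 and half-length s. *)
Lemma entropy_difference_le (s : R) : 0 <= s < 1 ->
  (1 + s) * ln (1 + s) - (1 - s) * ln (1 - s) <= 2 * s.
Proof.
  intros [[H0 | H0] H1].
  2: { subst s. rewrite Rplus_0_r, Rminus_0_r, ln_1. lra. }
  set (phi := fun x => (1 + x) * ln (1 + x) - (1 - x) * ln (1 - x) - 2 * x).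
  assert (Hd : forall x, 0 <= x <= s -> is_derive phi x (ln (1 + x) + ln (1 - x))).
  { intros x Hx. unfold phi. auto_derive.
    - split; [lra | split; [lra | exact I]].
    - unfold Rminus. field. lra. }
  destruct (MVT_gen phi 0 s (fun x => ln (1 + x) + ln (1 - x))) as [x [Hx Hphi]].
  - intros x Hx. rewrite Rmin_left, Rmax_right in Hx by lra. apply Hd. lra.
  - intros x Hx. rewrite Rmin_left, Rmax_right in Hx by lra.
    apply continuity_pt_filterlim, (@ex_derive_continuous R_AbsRing R_NormedModule).
    eexists. apply Hd. lra.
  - rewrite Rmin_left, Rmax_right in Hx by lra.
    assert (Hln : ln (1 + x) + ln (1 - x) <= 0).
    { assert (A := ln_le_sub_1 (1 + x) ltac:(lra)).
      assert (B := ln_le_sub_1 (1 - x) ltac:(lra)). lra. }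
    assert (Hz : phi 0 = 0).
    { unfold phi. rewrite Rplus_0_r, Rminus_0_r, ln_1. ring. }
    rewrite Hz in Hphi. unfold phi in Hphi. nra.
Qed.

(* The increment of [x ln x - x] over a unit interval is the mean of [ln] there,
   at most the value of [ln] at the midpoint by concavity. *)
Lemma ln_fact_ge (k : nat) :
  (INR k + / 2) * ln (INR k + / 2) - (INR k + / 2) <= ln (INR (fact k)).
Proof.
  induction k as [|k IH].
  - simpl. rewrite ln_1, Rplus_0_l.
    assert (H := ln_le_sub_1 (/ 2) ltac:(lra)). lra.
  - change (fact (S k)) with (S k * fact k)%nat. rewrite mult_INR, ln_mult.
    2: { apply lt_0_INR; lia. }
    2: { apply INR_fact_pos. }
    rewrite S_INR. assert (Hk := pos_INR k). set (x := INR k + 1) in *.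
    assert (Hx : 1 <= x) by (unfold x; lra).
    replace (INR k) with (x - 1) in IH by (unfold x; ring).
    (* With s = 1/(2x) the unit interval centred at x has ends x (1 - s) and x (1 + s). *)
    assert (Hs : 0 <= / (2 * x) < 1).
    { split. left; apply Rinv_0_lt_compat; lra. rewrite <- Rinv_1. apply Rinv_lt_contravar; lra. }
    assert (H := entropy_difference_le _ Hs).
    replace (x + / 2) with (x * (1 + / (2 * x))) by (field; lra).
    replace (x - 1 + / 2) with (x * (1 - / (2 * x))) in IH by (field; lra).
    rewrite ln_mult in IH |- * by lra.
    assert (Hxs : x * / (2 * x) = / 2) by (field; lra).
    set (s := / (2 * x)) in *.
    assert (H2 := Rmult_le_compat_l x _ _ ltac:(lra) H).
    assert (H3 : x * s * ln x = / 2 * ln x) by (rewrite Hxs; reflexivity).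
    lra.
Qed.

Lemma sqrt_mul_exp_term_le (r : R) (k : nat) : 0 < r ->
  sqrt r * (r ^ k / INR (fact k)) <= exp r.
Proof.
  intros Hr. assert (Hf := INR_fact_pos k). assert (Hk := pos_INR k).
  assert (Hk2 : 0 < INR k + / 2) by lra.
  (* [r^(k+1/2) e^(-r)] is maximal at [r = k + 1/2]. *)
  rewrite <- (Rpower_pow k r Hr), <- (Rpower_sqrt r Hr).
  unfold Rdiv. rewrite <- Rmult_assoc, <- Rpower_plus.
  apply Rmult_le_reg_r with (INR (fact k)); [exact Hf|].
  rewrite Rmult_assoc, Rinv_l, Rmult_1_r by lra.
  rewrite <- (exp_ln (INR (fact k))) by exact Hf. unfold Rpower. rewrite <- exp_plus.
  apply exp_monotone. assert (H := ln_fact_ge k).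
  (* The tangent inequality for ln at k + 1/2 proves this maximality. The maximal value is exactly
     the lower bound for k! in [ln_fact_ge], which is why the constant is 1. *)
  assert (H1 := ln_le_sub_1 (r / (INR k + / 2)) ltac:(apply Rdiv_lt_0_compat; lra)).
  rewrite ln_div in H1 by lra.
  assert (H2 := Rmult_le_compat_l (INR k + / 2) _ _ ltac:(lra) H1).
  replace ((INR k + / 2) * (r / (INR k + / 2) - 1)) with (r - (INR k + / 2)) in H2 by (field; lra).
  lra.
Qed.

(** For k <= r the factor r^th suffices; for k > r one has (k/r)^th <= k/r because th <= 1. The
    bound is affine in k, so summing it against r^k / k! needs only the first moment. The index 0 is
    excluded since [Rpower 0 th] is 1. *)
Lemma Rpower_nat_le (k : nat) (th r : R) : (1 <= k)%nat -> 0 <= th <= 1 -> 0 < r ->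
  Rpower (INR k) th <= Rpower r th * (1 + INR k / r).
Proof.
  intros Hk Hth Hr. assert (Hk1 : 1 <= INR k) by (apply (le_INR 1); exact Hk).
  assert (Hp : 0 < Rpower r th) by apply exp_pos.
  assert (Hq : 0 < INR k / r) by (apply Rdiv_lt_0_compat; lra).
  destruct (Rle_dec (INR k) r) as [H | H].
  - apply Rle_trans with (Rpower r th).
    + apply Rle_Rpower_l; lra.
    + nra.
  - replace (INR k) with (r * (INR k / r)) at 1 by (field; lra).
    rewrite <- Rpower_mult_distr by lra.
    apply Rmult_le_compat_l; [lra|].
    assert (H1 : 1 <= INR k / r).
    { apply Rmult_le_reg_r with r; [exact Hr|]. unfold Rdiv. rewrite Rmult_assoc, Rinv_l; lra. }
    apply Rle_trans with (Rpower (INR k / r) 1).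
    + apply Rle_Rpower; lra.
    + rewrite Rpower_1 by lra. lra.
Qed.

Lemma is_series_exp_first_moment (r : R) :
  is_series (fun k => INR k * r ^ k / INR (fact k)) (r * exp r).
Proof.
  apply is_series_decr_1.
  apply is_series_ext with (fun k => r * (r ^ k / INR (fact k))).
  - intros k. change (fact (S k)) with (S k * fact k)%nat. rewrite mult_INR. simpl pow.
    match goal with |- ?x = ?y => change (@eq R x y) end.
    field. split. apply INR_fact_neq_0. apply not_0_INR; lia.
  - match goal with |- is_series _ ?l => replace l with (r * exp r) end.
    + exact (is_series_scal r _ _ (is_series_exp r)).
    + unfold plus, opp; simpl. field.
Qed.

(** The two halves of the affine majorant contribute r^th e^r each. The lemma serves twice: with b =
    a and th = d for the supremum, with b = a^2 and th = 2 d for the mean square. *)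
Lemma exp_moment_le (b : nat -> R) (th r : R) : 0 <= th <= 1 -> 0 < r ->
  (forall k, 0 <= b k) -> b 0%nat = 0 -> (forall k, (1 <= k)%nat -> b k <= Rpower (INR k) th) ->
  ex_series (fun k => b k * r ^ k / INR (fact k)) /\
  Series (fun k => b k * r ^ k / INR (fact k)) <= 2 * Rpower r th * exp r.
Proof.
  intros Hth Hr Hb Hb0 Hb1.
  set (v := fun k => Rpower r th * (r ^ k / INR (fact k) + / r * (INR k * r ^ k / INR (fact k)))).
  assert (Hv : is_series v (2 * Rpower r th * exp r)).
  { replace (2 * Rpower r th * exp r) with (Rpower r th * (exp r + / r * (r * exp r))) by (field; lra).
    apply (is_series_scal (Rpower r th) (fun k => r ^ k / INR (fact k) + / r * (INR k * r ^ k / INR (fact k)))).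
    apply (is_series_plus (fun k => r ^ k / INR (fact k)) (fun k => / r * (INR k * r ^ k / INR (fact k)))).
    apply is_series_exp.
    apply (is_series_scal (/ r) (fun k => INR k * r ^ k / INR (fact k))).
    apply is_series_exp_first_moment. }
  assert (Hle : forall k, 0 <= b k * r ^ k / INR (fact k) <= v k).
  { intros k. assert (Hf := INR_fact_pos k). assert (Hp : 0 < r ^ k) by (apply pow_lt; lra).
    assert (Ht : 0 < r ^ k / INR (fact k)) by (apply Rdiv_lt_0_compat; lra).
    replace (b k * r ^ k / INR (fact k)) with (b k * (r ^ k / INR (fact k))) by (unfold Rdiv; ring).
    split.
    - apply Rmult_le_pos; [apply Hb | lra].
    - replace (v k) with (Rpower r th * (1 + INR k / r) * (r ^ k / INR (fact k)))
        by (unfold v; field; lra).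
      apply Rmult_le_compat_r; [lra|].
      destruct k as [|k].
      + rewrite Hb0. assert (H := exp_pos (th * ln r)). fold (Rpower r th) in H. simpl.
        unfold Rdiv. rewrite Rmult_0_l. lra.
      + apply Rle_trans with (1 := Hb1 (S k) ltac:(lia)). apply Rpower_nat_le; try lra; lia. }
  split.
  - apply ex_series_le_R with v; [|eexists; exact Hv].
    intros k. rewrite Rabs_pos_eq; apply Hle.
  - rewrite <- (is_series_unique _ _ Hv). apply Series_le. exact Hle. eexists; exact Hv.
Qed.

(** * Parseval for trigonometric sums, then for absolutely summable series *)

Lemma is_RInt_cos_nat (j : nat) : (1 <= j)%nat ->
  is_RInt (fun t => cos (INR j * t)) 0 (2 * PI) 0.
Proof.
  intros Hj. assert (Hj0 : INR j <> 0) by (apply not_0_INR; lia).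
  replace 0 with (minus (sin (INR j * (2 * PI)) / INR j) (sin (INR j * 0) / INR j)) at 2.
  - apply (@is_RInt_derive R_CompleteNormedModule (fun t => sin (INR j * t) / INR j)).
    + intros x _. auto_derive. exact I. field. exact Hj0.
    + intros x _. apply (@ex_derive_continuous R_AbsRing R_NormedModule). auto_derive. exact I.
  - unfold minus, plus, opp; simpl.
    replace (INR j * (2 * PI)) with (0 + 2 * INR j * PI) by ring.
    rewrite sin_period, Rmult_0_r, sin_0. field. exact Hj0.
Qed.

Definition cos_sum (c : nat -> R) (N : nat) (t : R) : R := sum_f_R0 (fun k => c k * cos (INR k * t)) N.
Definition sin_sum (c : nat -> R) (N : nat) (t : R) : R := sum_f_R0 (fun k => c k * sin (INR k * t)) N.

(** Keeping cosines and sines together, as the real part of a product with a conjugate, gives cos (k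
    t) cos (m t) + sin (k t) sin (m t) = cos ((m - k) t), so the integral of a single cosine
    suffices. *)
Lemma is_RInt_trig_sum_orthogonal (c : nat -> R) (N m : nat) : (N < m)%nat ->
  is_RInt (fun t => cos_sum c N t * cos (INR m * t) + sin_sum c N t * sin (INR m * t)) 0 (2 * PI) 0.
Proof.
  intros Hm.
  assert (Hterm : forall k, (k < m)%nat -> is_RInt
    (fun t => c k * cos (INR k * t) * cos (INR m * t) + c k * sin (INR k * t) * sin (INR m * t))
    0 (2 * PI) 0).
  { intros k Hk. replace 0 with (scal (c k) 0) at 2 by (unfold scal; simpl; unfold mult; simpl; ring).
    apply is_RInt_ext with (fun t => scal (c k) (cos (INR (m - k) * t))).
    - intros t _. rewrite minus_INR by lia.
      replace ((INR m - INR k) * t) with (INR m * t - INR k * t) by ring.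
      rewrite cos_minus. unfold scal; simpl; unfold mult; simpl. ring.
    - apply (@is_RInt_scal R_NormedModule). apply is_RInt_cos_nat. lia. }
  induction N as [|N IH].
  - apply Hterm, Hm.
  - replace 0 with (plus 0 0) at 2 by (unfold plus; simpl; ring).
    apply is_RInt_ext with (fun t => plus
      (cos_sum c N t * cos (INR m * t) + sin_sum c N t * sin (INR m * t))
      (c (S N) * cos (INR (S N) * t) * cos (INR m * t) + c (S N) * sin (INR (S N) * t) * sin (INR m * t))).
    + intros t _. unfold cos_sum, sin_sum. rewrite !tech5. unfold plus; simpl. ring.
    + apply (@is_RInt_plus R_NormedModule). apply IH; lia. apply Hterm; lia.
Qed.

Lemma is_RInt_const_2PI (v : R) : is_RInt (fun _ => v) 0 (2 * PI) (2 * PI * v).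
Proof.
  replace (2 * PI * v) with (scal (2 * PI - 0) v)
    by (unfold scal; simpl; unfold mult; simpl; ring).
  apply (@is_RInt_const R_NormedModule).
Qed.

(** Adding one frequency: |S + c e^(imt)|^2 is |S|^2 + c^2 plus a cross term whose integral vanishes
    by orthogonality. *)
Lemma is_RInt_trig_sum_sqr (c : nat -> R) (N : nat) :
  is_RInt (fun t => cos_sum c N t * cos_sum c N t + sin_sum c N t * sin_sum c N t)
    0 (2 * PI) (2 * PI * sum_f_R0 (fun k => c k * c k) N).
Proof.
  assert (Hone : forall k x, c k * cos x * (c k * cos x) + c k * sin x * (c k * sin x) = c k * c k).
  { intros k x. assert (H := sin2_cos2 x). unfold Rsqr in H.
    transitivity (c k * c k * (sin x * sin x + cos x * cos x)). ring. rewrite H. ring. }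
  induction N as [|N IH].
  - apply is_RInt_ext with (fun _ => c 0%nat * c 0%nat).
    + intros t _. symmetry. apply Hone.
    + apply is_RInt_const_2PI.
  - rewrite tech5.
    replace (2 * PI * (sum_f_R0 (fun k => c k * c k) N + c (S N) * c (S N)))
      with (plus (plus (2 * PI * sum_f_R0 (fun k => c k * c k) N) (2 * PI * (c (S N) * c (S N))))
        (scal (2 * c (S N)) 0))
      by (unfold plus, scal; simpl; unfold mult; simpl; ring).
    apply is_RInt_ext with (fun t => plus (plus
      (cos_sum c N t * cos_sum c N t + sin_sum c N t * sin_sum c N t) (c (S N) * c (S N)))
      (scal (2 * c (S N)) (cos_sum c N t * cos (INR (S N) * t) + sin_sum c N t * sin (INR (S N) * t)))).
    + intros t _. rewrite <- (Hone (S N) (INR (S N) * t)).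
      unfold cos_sum, sin_sum. rewrite !tech5. unfold plus, scal; simpl plus; unfold mult.
      cbn -[INR sum_f_R0]. ring.
    + apply (@is_RInt_plus R_NormedModule). apply (@is_RInt_plus R_NormedModule).
      exact IH. apply is_RInt_const_2PI.
      apply (@is_RInt_scal R_NormedModule). apply is_RInt_trig_sum_orthogonal. lia.
Qed.

(** Error, uniform in t, of truncating at [sum_f_R0 _ N]; it starts at [S N] because that sum
    includes the index [N]. *)
Definition tail (c : nat -> R) (N : nat) : R := Series (fun k => Rabs (c (S N + k)%nat)).

Lemma tail_lim (c : nat -> R) : ex_series (fun k => Rabs (c k)) -> is_lim_seq (tail c) 0.
Proof.
  intros Hc.
  apply is_lim_seq_ext with (fun N => Series (fun k => Rabs (c k)) - sum_f_R0 (fun k => Rabs (c k)) N).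
  - intros N. rewrite (Series_incr_n (fun k => Rabs (c k)) (S N)) by (try lia; exact Hc).
    unfold tail. simpl pred. ring.
  - replace (Finite 0) with (Rbar_minus (Series (fun k => Rabs (c k))) (Series (fun k => Rabs (c k))))
      by (simpl; f_equal; ring).
    apply is_lim_seq_minus'. apply is_lim_seq_const.
    apply is_lim_seq_ext with (sum_n (fun k => Rabs (c k))). intros n; apply sum_n_Reals.
    apply Series_correct, Hc.
Qed.

(** Factor x^2 - y^2 = (x - y)(x + y), with x the series and y its partial sum: the first factor is
    at most the tail, the second at most twice the absolute sum. In the application [w] is a cosine
    or a sine at a fixed t, and the bound does not depend on t. *)
Lemma Series_sqr_sub_le (c w : nat -> R) (N : nat) : ex_series (fun k => Rabs (c k)) ->
  (forall k, Rabs (w k) <= 1) ->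
  Series (fun k => c k * w k) * Series (fun k => c k * w k)
  <= sum_f_R0 (fun k => c k * w k) N * sum_f_R0 (fun k => c k * w k) N
     + 2 * Series (fun k => Rabs (c k)) * tail c N.
Proof.
  intros Hc Hw.
  assert (Hcw : forall k, Rabs (c k * w k) <= Rabs (c k)).
  { intros k. rewrite Rabs_mult. assert (H1 := Hw k). assert (H2 := Rabs_pos (c k)). nra. }
  assert (Habs : ex_series (fun k => Rabs (c k * w k))).
  { apply ex_series_le_R with (2 := Hc). intros k. rewrite Rabs_Rabsolu. apply Hcw. }
  assert (Hex : ex_series (fun k => c k * w k)) by (apply ex_series_le_R with (2 := Hc); exact Hcw).
  assert (Hex1 : ex_series (fun k => Rabs (c (S N + k)%nat))).
  { apply (ex_series_incr_n (fun k => Rabs (c k)) (S N)), Hc. }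
  set (x := Series (fun k => c k * w k)). set (y := sum_f_R0 (fun k => c k * w k) N).
  set (s := Series (fun k => Rabs (c k))).
  assert (Hx : Rabs x <= s).
  { apply Rle_trans with (1 := Series_Rabs _ Habs). apply Series_le; [|exact Hc].
    intros k. split. apply Rabs_pos. apply Hcw. }
  assert (Hsplit : s = sum_f_R0 (fun k => Rabs (c k)) N + tail c N).
  { unfold s. rewrite (Series_incr_n (fun k => Rabs (c k)) (S N)) by (try lia; exact Hc). reflexivity. }
  assert (Ht : 0 <= tail c N).
  { unfold tail. apply Rle_trans with (Series (fun k => 0 * Rabs (c (S N + k)%nat))).
    rewrite Series_scal_l. lra. apply Series_le; [|exact Hex1].
    intros k. assert (H := Rabs_pos (c (S N + k)%nat)). split; lra. }
  assert (Hy : Rabs y <= s).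
  { rewrite Hsplit. apply Rle_trans with (sum_f_R0 (fun k => Rabs (c k)) N); [|lra].
    apply Rle_trans with (1 := Rsum_abs _ _). apply sum_Rle. intros k _. apply Hcw. }
  assert (Hxy : Rabs (x - y) <= tail c N).
  { unfold x. rewrite (Series_incr_n (fun k => c k * w k) (S N)) by (try lia; exact Hex).
    simpl pred. fold y.
    replace (y + Series (fun k => c (S N + k)%nat * w (S N + k)%nat) - y)
      with (Series (fun k => c (S N + k)%nat * w (S N + k)%nat)) by ring.
    assert (He : ex_series (fun k => Rabs (c (S N + k)%nat * w (S N + k)%nat))).
    { apply ex_series_le_R with (2 := Hex1). intros k. rewrite Rabs_Rabsolu. apply Hcw. }
    apply Rle_trans with (1 := Series_Rabs _ He). apply Series_le; [|exact Hex1].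
    intros k. split. apply Rabs_pos. apply Hcw. }
  apply Rabs_le_between in Hx. apply Rabs_le_between in Hy.
  assert (H : (x - y) * (x + y) <= tail c N * (2 * s)).
  { apply Rle_trans with (1 := Rle_abs _). rewrite Rabs_mult.
    apply Rmult_le_compat; try apply Rabs_pos. exact Hxy. apply Rabs_le. lra. }
  nra.
Qed.

(** Only an inequality is needed, so limit and integral are never exchanged: for each N the
    integrand is at most the truncated one plus the constant 4 s tail(N), half of it from the
    cosines and half from the sines, and then N tends to infinity. *)
Lemma RInt_trig_series_sqr_le (c : nat -> R) :
  let g t := Series (fun k => c k * cos (INR k * t)) * Series (fun k => c k * cos (INR k * t))
             + Series (fun k => c k * sin (INR k * t)) * Series (fun k => c k * sin (INR k * t)) in
  ex_series (fun k => Rabs (c k)) -> ex_series (fun k => c k * c k) ->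
  ex_RInt g 0 (2 * PI) ->
  RInt g 0 (2 * PI) <= 2 * PI * Series (fun k => c k * c k).
Proof.
  intros g Hc Hc2 Hg. assert (HPI := PI_RGT_0).
  set (s := Series (fun k => Rabs (c k))).
  assert (H : forall N, RInt g 0 (2 * PI)
     <= 2 * PI * Series (fun k => c k * c k) + 2 * PI * (4 * s * tail c N)).
  { intros N.
    assert (Hp := @is_RInt_plus R_NormedModule _ _ _ _ _ _
      (is_RInt_trig_sum_sqr c N) (is_RInt_const_2PI (4 * s * tail c N))).
    apply Rle_trans with (plus (2 * PI * sum_f_R0 (fun k => c k * c k) N) (2 * PI * (4 * s * tail c N))).
    - match type of Hp with is_RInt ?h _ _ _ => apply Rle_trans with (RInt h 0 (2 * PI)) end;
        [|right; exact (is_RInt_unique _ _ _ _ Hp)].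
      apply RInt_le.
      + lra.
      + exact Hg.
      + eexists; exact Hp.
      + intros t _. unfold g.
        assert (H1 := Series_sqr_sub_le c (fun k => cos (INR k * t)) N Hc
          ltac:(intros k; apply Rabs_le, COS_bound)).
        assert (H2 := Series_sqr_sub_le c (fun k => sin (INR k * t)) N Hc
          ltac:(intros k; apply Rabs_le, SIN_bound)).
        fold s in H1, H2. simpl in H1, H2. unfold plus; simpl. unfold cos_sum, sin_sum. lra.
    - unfold plus; simpl. apply Rplus_le_compat_r. apply Rmult_le_compat_l; [lra|].
      rewrite (Series_incr_n (fun k => c k * c k) (S N)) by (try lia; exact Hc2). simpl pred.
      assert (Hex := proj1 (ex_series_incr_n (fun k => c k * c k) (S N)) Hc2).
      assert (H0 : 0 <= Series (fun k => c (S N + k)%nat * c (S N + k)%nat)); [|lra].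
      apply Rle_trans with (Series (fun k => 0 * (c (S N + k)%nat * c (S N + k)%nat))).
      rewrite Series_scal_l. lra. apply Series_le; [|exact Hex].
      intros k. assert (H0 := Rle_0_sqr (c (S N + k)%nat)). unfold Rsqr in H0. split; lra. }
  assert (Hl := is_lim_seq_le (fun _ => RInt g 0 (2 * PI)) _ (RInt g 0 (2 * PI))
    (2 * PI * Series (fun k => c k * c k)) H (is_lim_seq_const _)).
  apply Hl.
  replace (Finite (2 * PI * Series (fun k => c k * c k)))
    with (Rbar_plus (2 * PI * Series (fun k => c k * c k)) (2 * PI * (4 * s * 0)))
    by (simpl; f_equal; ring).
  apply is_lim_seq_plus'. apply is_lim_seq_const.
  apply is_lim_seq_mult'; [apply is_lim_seq_const|].
  apply is_lim_seq_mult'; [apply is_lim_seq_const|].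
  apply tail_lim, Hc.
Qed.

(** * Integral means *)

Lemma rpow_nonneg (x y : R) : 0 <= rpow x y.
Proof. unfold rpow. destruct (Req_dec_T x 0); [lra | left; apply exp_pos]. Qed.

Lemma rpow_le_Rpower (x y q : R) : 0 <= x <= y -> 0 < y -> 0 <= q -> rpow x q <= Rpower y q.
Proof.
  intros Hx Hy Hq. unfold rpow. destruct (Req_dec_T x 0).
  - left; apply exp_pos.
  - apply Rle_Rpower_l; lra.
Qed.

(** Needed for the integrability of |f|^p on a circle where f may have zeros. At 0 the radius
    e^(1/p) works; elsewhere the function is locally exp (p ln |y|). *)
Lemma continuous_rpow_Rabs (p x : R) : 0 < p -> continuous (fun y => rpow (Rabs y) p) x.
Proof.
  intros Hp. destruct (Req_dec_T x 0) as [H | H].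
  - subst x. intros P [e HP].
    assert (Hd : 0 < Rpower e (1 / p)) by apply exp_pos.
    exists (mkposreal _ Hd). intros y Hy. apply HP.
    change (Rabs (y - 0) < Rpower e (1 / p)) in Hy. rewrite Rminus_0_r in Hy.
    change (Rabs (rpow (Rabs y) p - rpow (Rabs 0) p) < e).
    replace (rpow (Rabs 0) p) with 0.
    2: { unfold rpow. rewrite Rabs_R0. destruct (Req_dec_T 0 0); [reflexivity | lra]. }
    rewrite Rminus_0_r, Rabs_pos_eq by apply rpow_nonneg.
    unfold rpow. destruct (Req_dec_T (Rabs y) 0) as [H | H]. apply cond_pos.
    assert (H0 := Rabs_pos y).
    replace (pos e) with (Rpower (Rpower e (1 / p)) p).
    + apply Rlt_Rpower_l; lra.
    + rewrite Rpower_mult. replace (1 / p * p) with 1 by (field; lra).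
      apply Rpower_1, cond_pos.
  - assert (Hx : 0 < Rabs x) by (apply Rabs_pos_lt, H).
    apply continuous_ext_loc with (fun y => exp (p * ln (Rabs y))).
    + exists (mkposreal _ Hx). intros y Hy. change (Rabs (y - x) < Rabs x) in Hy.
      unfold rpow. destruct (Req_dec_T (Rabs y) 0) as [H1 | H1]; [|reflexivity].
      exfalso. assert (H2 := Rabs_triang_inv x y). rewrite Rabs_minus_sym in Hy. lra.
    + apply continuous_comp; [|apply continuous_exp].
      apply (continuous_mult (fun _ => p) (fun y => ln (Rabs y))). apply continuous_const.
      apply continuous_comp. apply continuous_Rabs.
      apply continuity_pt_filterlim, derivable_continuous_pt.
      exists (/ Rabs x). apply derivable_pt_lim_ln, Hx.
Qed.

Lemma rpow_le_of_le_sup (x s p : R) : 0 <= x <= s -> 0 < s -> 2 <= p ->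
  rpow x p <= Rpower s (p - 2) * (x * x).
Proof.
  intros Hx Hs Hp. unfold rpow. destruct (Req_dec_T x 0) as [H | H].
  - subst x. lra.
  - replace p with ((p - 2) + INR 2) at 1 by (simpl; ring).
    rewrite Rpower_plus, Rpower_pow by lra.
    replace (x ^ 2) with (x * x) by ring.
    apply Rmult_le_compat_r. nra. apply Rle_Rpower_l; lra.
Qed.

(** Split at x = l: below, x^p <= l^p; above, x^(p-2) <= l^(p-2) because p - 2 <= 0. *)
Lemma rpow_le_sum (x l p : R) : 0 <= x -> 0 < l -> 0 <= p <= 2 ->
  rpow x p <= Rpower l p + Rpower l (p - 2) * (x * x).
Proof.
  intros Hx Hl Hp. assert (H1 := exp_pos (p * ln l)). fold (Rpower l p) in H1.
  assert (H2 := exp_pos ((p - 2) * ln l)). fold (Rpower l (p - 2)) in H2.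
  assert (Hxx : 0 <= Rpower l (p - 2) * (x * x)) by (apply Rmult_le_pos; nra).
  destruct (Rle_dec x l) as [H | H].
  - apply Rle_trans with (Rpower l p); [|lra]. apply rpow_le_Rpower; lra.
  - apply Rle_trans with (Rpower l (p - 2) * (x * x)); [|lra].
    unfold rpow. destruct (Req_dec_T x 0) as [H0 | H0]. lra.
    replace p with ((p - 2) + INR 2) at 1 by (simpl; ring).
    rewrite Rpower_plus, Rpower_pow by lra.
    replace (x ^ 2) with (x * x) by ring.
    apply Rmult_le_compat_r. nra.
    unfold Rpower. apply exp_monotone.
    assert (H3 : ln l <= ln x) by (apply ln_le; lra). nra.
Qed.

Definition on_circle (f : C -> C) (r t : R) : R := Cmod (f (r * cos t, r * sin t)).

Lemma Cmod_polar (r t : R) : 0 <= r -> Cmod (r * cos t, r * sin t) = r.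
Proof.
  intros Hr. unfold Cmod. simpl.
  replace (r * cos t * (r * cos t * 1) + r * sin t * (r * sin t * 1))
    with (Rsqr r * (Rsqr (sin t) + Rsqr (cos t))) by (unfold Rsqr; ring).
  rewrite sin2_cos2, Rmult_1_r. apply sqrt_Rsqr, Hr.
Qed.

Lemma pow_polar (r t : R) (k : nat) :
  ((r * cos t, r * sin t)%R ^ k)%C = (r ^ k * cos (INR k * t), r ^ k * sin (INR k * t))%R.
Proof.
  induction k as [|k IH].
  - simpl. rewrite Rmult_0_l, cos_0, sin_0. unfold RtoC. f_equal; ring.
  - rewrite Cpow_S, IH, S_INR. replace ((INR k + 1) * t) with (t + INR k * t) by ring.
    rewrite cos_plus, sin_plus. unfold Cmult. simpl. f_equal; ring.
Qed.

Lemma continuous_on_circle (a : nat -> R) (r t : R) : exp_bounded a ->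
  continuous (on_circle (egf a) r) t.
Proof.
  intros Ha. unfold on_circle.
  apply (@continuous_comp R_UniformSpace C_UniformSpace R_UniformSpace
    (fun t => (r * cos t, r * sin t)) (fun w => Cmod (egf a w))).
  - apply (@continuous_comp_2 R_UniformSpace R_UniformSpace R_UniformSpace C_UniformSpace
      (fun t => r * cos t) (fun t => r * sin t) (fun x y => (x, y))).
    + apply (@ex_derive_continuous R_AbsRing R_NormedModule). auto_derive. exact I.
    + apply (@ex_derive_continuous R_AbsRing R_NormedModule). auto_derive. exact I.
    + intros P HP. unfold filtermap. apply filter_imp with (2 := HP). intros [x y] Hxy. exact Hxy.
  - apply continuous_egf, Ha.
Qed.

Lemma ex_RInt_rpow_on_circle (a : nat -> R) (r p : R) : exp_bounded a -> 0 < p ->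
  ex_RInt (fun t => rpow (on_circle (egf a) r t) p) 0 (2 * PI).
Proof.
  intros Ha Hp.
  apply ex_RInt_ext with (fun t => rpow (Rabs (on_circle (egf a) r t)) p).
  - intros t _. rewrite Rabs_pos_eq. reflexivity. apply Cmod_ge_0.
  - apply (@ex_RInt_continuous R_CompleteNormedModule). intros t _.
    apply (continuous_comp (on_circle (egf a) r) (fun y => rpow (Rabs y) p)).
    apply continuous_on_circle, Ha. apply continuous_rpow_Rabs, Hp.
Qed.

Lemma ex_RInt_on_circle_sqr (a : nat -> R) (r : R) : exp_bounded a ->
  ex_RInt (fun t => on_circle (egf a) r t * on_circle (egf a) r t) 0 (2 * PI).
Proof.
  intros Ha. apply (@ex_RInt_continuous R_CompleteNormedModule). intros t _.
  apply (continuous_mult (on_circle (egf a) r) (on_circle (egf a) r)); apply continuous_on_circle, Ha.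
Qed.

(** Disposes of the normalisation and the p-th root once and for all, so that later estimates
    concern plain integrals. *)
Lemma Mp_le (a : nat -> R) (p r l : R) : exp_bounded a -> 0 < p -> 0 < l ->
  RInt (fun t => rpow (on_circle (egf a) r t) p) 0 (2 * PI) <= 2 * PI * Rpower l p ->
  Rbar_le (Mp p (egf a) r) l.
Proof.
  intros Ha Hp Hl H. assert (HPI := PI_RGT_0).
  assert (Hroot : forall v, 0 <= v -> v <= 2 * PI * Rpower l p -> rpow (1 / (2 * PI) * v) (1 / p) <= l).
  { intros v Hv Hvl.
    assert (Hv1 : 1 / (2 * PI) * v <= Rpower l p).
    { apply Rmult_le_reg_l with (2 * PI). lra.
      replace (2 * PI * (1 / (2 * PI) * v)) with v by (field; lra). exact Hvl. }
    apply Rle_trans with (Rpower (Rpower l p) (1 / p)).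
    - apply rpow_le_Rpower.
      + split; [|exact Hv1]. apply Rmult_le_pos; [|exact Hv].
        left; apply Rdiv_lt_0_compat; lra.
      + apply exp_pos.
      + left; apply Rdiv_lt_0_compat; lra.
    - right. rewrite Rpower_mult. replace (p * (1 / p)) with 1 by (field; lra). apply Rpower_1, Hl. }
  apply Hroot; [|exact H].
  apply RInt_ge_0. lra. apply ex_RInt_rpow_on_circle; assumption. intros t _. apply rpow_nonneg.
Qed.

(** A normalised mean never exceeds a uniform bound. This settles p = oo, and all p at once for
    radii below 1. *)
Lemma Mp_le_sup (a : nat -> R) (p : Rbar) (r l : R) : exp_bounded a -> Rbar_le 1 p -> 0 <= r -> 0 < l ->
  (forall z, Cmod z = r -> Cmod (egf a z) <= l) -> Rbar_le (Mp p (egf a) r) l.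
Proof.
  intros Ha Hp Hr Hl H. assert (HPI := PI_RGT_0). destruct p as [p | |].
  - simpl in Hp. apply Mp_le; try assumption; try lra.
    replace (2 * PI * Rpower l p) with (RInt (fun _ => Rpower l p) 0 (2 * PI)).
    + apply RInt_le. lra. apply ex_RInt_rpow_on_circle; try assumption; lra. apply ex_RInt_const.
      intros t _. apply rpow_le_Rpower; try lra. split. apply Cmod_ge_0.
      apply H. apply Cmod_polar, Hr.
    + rewrite RInt_const. unfold scal; simpl; unfold mult; simpl. ring.
  - unfold Mp, sup_norm. apply Lub_Rbar_correct. intros y [z [Hz Hy]]. subst y.
    apply H. exact Hz.
  - destruct Hp.
Qed.

Lemma RInt_on_circle_sqr_le (a : nat -> R) (r : R) : exp_bounded a -> 0 <= r ->
  let c k := a k * r ^ k / INR (fact k) in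
  ex_series (fun k => c k * c k) ->
  RInt (fun t => on_circle (egf a) r t * on_circle (egf a) r t) 0 (2 * PI)
  <= 2 * PI * Series (fun k => c k * c k).
Proof.
  intros Ha Hr c Hc2.
  assert (Hc : ex_series (fun k => Rabs (c k))).
  { apply ex_series_ext with (2 := ex_series_egf_abs a r Ha Hr). intros k. unfold c, Rdiv.
    rewrite !Rabs_mult, (Rabs_pos_eq (r ^ k)), (Rabs_pos_eq (/ _)).
    reflexivity. left; apply Rinv_0_lt_compat, INR_fact_pos. apply pow_le, Hr. }
  assert (E : forall t, on_circle (egf a) r t * on_circle (egf a) r t =
    Series (fun k => c k * cos (INR k * t)) * Series (fun k => c k * cos (INR k * t))
    + Series (fun k => c k * sin (INR k * t)) * Series (fun k => c k * sin (INR k * t))).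
  { intros t. unfold on_circle. rewrite Cmod_sqr.
    replace (fst (egf a (r * cos t, r * sin t))) with (Series (fun k => c k * cos (INR k * t))).
    replace (snd (egf a (r * cos t, r * sin t))) with (Series (fun k => c k * sin (INR k * t))).
    reflexivity.
    - apply Series_ext. intros k. rewrite pow_polar. unfold c, Rdiv. simpl. ring.
    - apply Series_ext. intros k. rewrite pow_polar. unfold c, Rdiv. simpl. ring. }
  rewrite (RInt_ext _ _ _ _ (fun t _ => E t)).
  apply RInt_trig_series_sqr_le; try assumption.
  apply ex_RInt_ext with (2 := ex_RInt_on_circle_sqr a r Ha). intros t _. apply E.
Qed.

Lemma INR_succ_le_pow2 (k : nat) : INR k + 1 <= 2 ^ k.
Proof.
  induction k as [|k IH]. simpl; lra.
  rewrite S_INR. simpl pow. assert (H := pow_R1_Rle 2 k ltac:(lra)). lra.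
Qed.

(** * Growth of the function when its coefficients lie between 0 and k^d *)

Section growth.

Variables (a : nat -> R) (d : R).
Hypothesis Hd : 0 <= d <= / 2.
Hypothesis Ha0 : a 0%nat = 0.
Hypothesis Hpos : forall k, 0 <= a k.
Hypothesis Hle : forall k, (1 <= k)%nat -> a k <= Rpower (INR k) d.

Lemma coef_le_INR (k : nat) : a k <= INR k.
Proof.
  destruct k as [|k]. rewrite Ha0. simpl. lra.
  assert (Hk : 1 <= INR (S k)) by (apply (le_INR 1); lia).
  apply Rle_trans with (1 := Hle (S k) ltac:(lia)).
  apply Rle_trans with (Rpower (INR (S k)) 1).
  apply Rle_Rpower; lra. rewrite Rpower_1 by lra. lra.
Qed.

Lemma exp_bounded_coef : exp_bounded a.
Proof.
  exists 1. intros k. rewrite Rabs_pos_eq, Rmult_1_l by apply Hpos.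
  apply Rle_trans with (1 := coef_le_INR k). assert (H := INR_succ_le_pow2 k). lra.
Qed.

Lemma egf_sup_le (z : C) : 0 < Cmod z ->
  Cmod (egf a z) <= 2 * Rpower (Cmod z) d * exp (Cmod z).
Proof.
  intros Hz. apply Rle_trans with (1 := Cmod_egf_le a z exp_bounded_coef).
  rewrite (Series_ext _ (fun k => a k * Cmod z ^ k / INR (fact k)))
    by (intros k; rewrite Rabs_pos_eq by apply Hpos; reflexivity).
  apply exp_moment_le; try assumption. lra.
Qed.

(** In the unit disc |z|^k <= |z|^K for k >= K, and the remaining sum of k / k! is e <= 3. *)
Lemma egf_le_near_0 (K : nat) (z : C) : (forall k, (k < K)%nat -> a k = 0) -> Cmod z <= 1 ->
  Cmod (egf a z) <= 3 * Cmod z ^ K.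
Proof.
  intros HK Hz. apply Rle_trans with (1 := Cmod_egf_le a z exp_bounded_coef).
  assert (H0 := Cmod_ge_0 z). assert (H := is_series_exp_first_moment 1).
  assert (H1 := is_series_scal (Cmod z ^ K) _ _ H).
  apply Rle_trans with (Series (fun k => Cmod z ^ K * (INR k * 1 ^ k / INR (fact k)))).
  - apply Series_le. 2: eexists; exact H1.
    intros k. assert (Hf := Rinv_0_lt_compat _ (INR_fact_pos k)).
    rewrite Rabs_pos_eq by apply Hpos. assert (Hp := pow_le _ k H0). split.
    + apply Rmult_le_pos; [|lra]. apply Rmult_le_pos; [apply Hpos | exact Hp].
    + rewrite pow1. unfold Rdiv. rewrite Rmult_1_r, <- Rmult_assoc. apply Rmult_le_compat_r; [lra|].
      rewrite (Rmult_comm (Cmod z ^ K)).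
      destruct (Nat.lt_ge_cases k K) as [Hk | Hk].
      * rewrite HK by exact Hk. assert (H2 := pow_le _ K H0). assert (H3 := pos_INR k). nra.
      * apply Rmult_le_compat; try assumption. apply Hpos. apply coef_le_INR.
        replace k with (K + (k - K))%nat by lia. rewrite pow_add.
        assert (H2 := pow_le _ K H0). assert (H3 := pow_incr _ 1 (k - K) (conj H0 Hz)).
        rewrite pow1 in H3. nra.
  - replace (Series _) with (Cmod z ^ K * (1 * exp 1)).
    + assert (H2 := exp_le_3). assert (H3 := pow_le _ K H0). nra.
    + symmetry. exact (is_series_unique _ _ H1).
Qed.

(** In c_k^2 = (r^k / k!) (a_k^2 r^k / k!) the first factor is bounded uniformly by e^r / sqrt r,
    and the second is summed as a moment of order 2 d. *)
Lemma mean_square_le (r : R) : 0 < r ->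
  RInt (fun t => on_circle (egf a) r t * on_circle (egf a) r t) 0 (2 * PI)
  <= 2 * PI * (2 * Rpower r (2 * d) * exp r * (exp r / sqrt r)).
Proof.
  intros Hr. assert (HPI := PI_RGT_0). assert (Hs := sqrt_lt_R0 r Hr).
  set (c k := a k * r ^ k / INR (fact k)).
  destruct (exp_moment_le (fun k => a k * a k) (2 * d) r) as [Hex Hsum]; try lra.
  - intros k. assert (H := Hpos k). nra.
  - rewrite Ha0. ring.
  - intros k Hk. replace (2 * d) with (d + d) by ring. rewrite Rpower_plus.
    apply Rmult_le_compat; try apply Hpos; apply Hle, Hk.
  - assert (Hc : forall k, 0 <= c k * c k <= exp r / sqrt r * (a k * a k * r ^ k / INR (fact k))).
    { intros k. split.
      - exact (Rle_0_sqr (c k)).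
      - replace (c k * c k) with (r ^ k / INR (fact k) * (a k * a k * r ^ k / INR (fact k)))
          by (unfold c, Rdiv; ring).
        apply Rmult_le_compat_r.
        + apply Rmult_le_pos. apply Rmult_le_pos. exact (Rle_0_sqr (a k)). apply pow_le; lra.
          left; apply Rinv_0_lt_compat, INR_fact_pos.
        + apply Rmult_le_reg_l with (sqrt r); [exact Hs|].
          replace (sqrt r * (exp r / sqrt r)) with (exp r) by (field; lra).
          apply sqrt_mul_exp_term_le, Hr. }
    assert (He : 0 <= exp r / sqrt r) by (left; apply Rdiv_lt_0_compat; [apply exp_pos | exact Hs]).
    assert (Hex2 := ex_series_scal (exp r / sqrt r) _ Hex).
    assert (Hc2 : ex_series (fun k => c k * c k)).
    { apply ex_series_le_R with (2 := Hex2). intros k. rewrite Rabs_pos_eq; apply Hc. }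
    apply Rle_trans with (1 := RInt_on_circle_sqr_le a r exp_bounded_coef (Rlt_le _ _ Hr) Hc2).
    apply Rmult_le_compat_l; [lra|].
    apply Rle_trans with (Series (fun k => exp r / sqrt r * (a k * a k * r ^ k / INR (fact k)))).
    + apply Series_le. exact Hc. exact Hex2.
    + rewrite Series_scal_l, (Rmult_comm (_ * exp r)). apply Rmult_le_compat_l; assumption.
Qed.

(** With everything in one exponential, the comparisons to come are between combinations of ln 2, r
    and ln r. *)
Lemma mean_square_le_exp (r : R) : 0 < r ->
  RInt (fun t => on_circle (egf a) r t * on_circle (egf a) r t) 0 (2 * PI)
  <= 2 * PI * exp (ln 2 + 2 * d * ln r + 2 * r - / 2 * ln r).
Proof.
  intros Hr. apply Rle_trans with (1 := mean_square_le r Hr). right. f_equal.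
  rewrite <- (Rpower_sqrt r Hr). unfold Rpower, Rdiv. rewrite <- exp_Ropp.
  rewrite <- (exp_ln 2) at 1 by lra. rewrite <- !exp_plus. f_equal. ring.
Qed.

(* Interpolation: [|f|^p <= (sup |f|)^(p-2) |f|^2]. *)
Lemma Mp_egf_le_ge2 (p r : R) : 2 <= p -> 0 < r ->
  Rbar_le (Mp p (egf a) r) (4 * exp r * Rpower r (d - 1 / (2 * p))).
Proof.
  intros Hp Hr. assert (HPI := PI_RGT_0). assert (Ha := exp_bounded_coef).
  set (s := exp (ln 2 + d * ln r + r)).
  assert (Hs : 0 < s) by apply exp_pos.
  assert (Hsup : forall t, 0 <= on_circle (egf a) r t <= s).
  { intros t. split. apply Cmod_ge_0. unfold on_circle.
    apply Rle_trans with (1 := egf_sup_le (r * cos t, r * sin t) ltac:(rewrite Cmod_polar; lra)).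
    rewrite Cmod_polar by lra. right. unfold s, Rpower. rewrite !exp_plus, exp_ln; lra. }
  assert (H4 : ln 4 = 2 * ln 2).
  { replace 4 with (2 * 2) by ring. rewrite ln_mult; lra. }
  assert (Hln2 : 0 < ln 2) by (rewrite <- ln_1; apply ln_increasing; lra).
  set (l := exp (ln 4 + r + (d - 1 / (2 * p)) * ln r)).
  replace (4 * exp r * Rpower r (d - 1 / (2 * p))) with l.
  2: { unfold l, Rpower. rewrite !exp_plus, exp_ln; lra. }
  apply Mp_le; try assumption; try lra. apply exp_pos.
  assert (Hex := ex_RInt_on_circle_sqr a r Ha).
  apply Rle_trans with (RInt (fun t => Rpower s (p - 2) * (on_circle (egf a) r t * on_circle (egf a) r t)) 0 (2 * PI)).
  - apply RInt_le. lra. apply ex_RInt_rpow_on_circle; try assumption; lra.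
    exact (@ex_RInt_scal R_NormedModule _ _ _ (Rpower s (p - 2)) Hex).
    intros t _. apply rpow_le_of_le_sup; try assumption. apply Hsup.
  - apply Rle_trans with (Rpower s (p - 2) * RInt (fun t => on_circle (egf a) r t * on_circle (egf a) r t) 0 (2 * PI)).
    { right. exact (RInt_scal (fun t => on_circle (egf a) r t * on_circle (egf a) r t) _ _ (Rpower s (p - 2)) Hex). }
    apply Rle_trans with (Rpower s (p - 2) * (2 * PI * exp (ln 2 + 2 * d * ln r + 2 * r - / 2 * ln r))).
    + apply Rmult_le_compat_l. left; apply exp_pos. apply mean_square_le_exp, Hr.
    + rewrite <- Rmult_assoc, (Rmult_comm (Rpower s _)), Rmult_assoc. apply Rmult_le_compat_l; [lra|].
      unfold Rpower, s, l. rewrite !ln_exp, <- exp_plus. apply exp_monotone.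
      rewrite H4.
      (* The left side adds up to (p - 1) ln 2 + p r + p d ln r - 1/2 ln r: the terms in r and ln r
         agree exactly, and only multiples of ln 2 are compared. *)
      replace (p * (2 * ln 2 + r + (d - 1 / (2 * p)) * ln r))
        with (2 * (p * ln 2) + p * r + p * d * ln r - / 2 * ln r) by (field; lra).
      nra.
Qed.

(* Instead of Jensen: [|f|^p <= l^p + l^(p-2) |f|^2], with [l] of the order of [M_2]. *)
Lemma Mp_egf_le_le2 (p r : R) : 1 <= p <= 2 -> 0 < r ->
  Rbar_le (Mp p (egf a) r) (4 * exp r * Rpower r (d - / 4)).
Proof.
  intros Hp Hr. assert (HPI := PI_RGT_0). assert (Ha := exp_bounded_coef).
  (* l^2 is twice the bound on the mean square, so each of the two terms integrates to at most 2 pi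
     l^p. *)
  set (l := exp (ln 2 + r + (d - / 4) * ln r)).
  assert (Hl : 0 < l) by apply exp_pos.
  replace (4 * exp r * Rpower r (d - / 4)) with (2 * l).
  2: { unfold l, Rpower. rewrite !exp_plus, exp_ln; lra. }
  apply Mp_le; try assumption; try lra.
  assert (Hex := ex_RInt_on_circle_sqr a r Ha).
  assert (Hex2 := @ex_RInt_scal R_NormedModule _ _ _ (Rpower l (p - 2)) Hex).
  assert (Hc := @ex_RInt_const R_NormedModule 0 (2 * PI) (Rpower l p)).
  apply Rle_trans with (RInt (fun t => plus (Rpower l p)
    (scal (Rpower l (p - 2)) (on_circle (egf a) r t * on_circle (egf a) r t))) 0 (2 * PI)).
  - apply RInt_le. lra. apply ex_RInt_rpow_on_circle; try assumption; lra.
    exact (ex_RInt_plus _ _ _ _ Hc Hex2).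
    intros t _. apply rpow_le_sum; try lra. apply Cmod_ge_0.
  - assert (Hsum := @is_RInt_plus R_NormedModule _ _ _ _ _ _
      (@is_RInt_const R_NormedModule 0 (2 * PI) (Rpower l p))
      (@is_RInt_scal R_NormedModule _ _ _ (Rpower l (p - 2)) _
        (@RInt_correct R_CompleteNormedModule _ _ _ Hex))).
    apply Rle_trans with ((2 * PI - 0) * Rpower l p + Rpower l (p - 2)
      * RInt (fun t => on_circle (egf a) r t * on_circle (egf a) r t) 0 (2 * PI)).
    { right. exact (is_RInt_unique _ _ _ _ Hsum). }
    assert (Hlp := exp_pos (p * ln l)). fold (Rpower l p) in Hlp.
    assert (Hlp2 := exp_pos ((p - 2) * ln l)). fold (Rpower l (p - 2)) in Hlp2.
    apply Rle_trans with (2 * PI * Rpower l p + 2 * PI * Rpower l p).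
    + apply Rplus_le_compat. right; ring.
      apply Rle_trans with (Rpower l (p - 2) * (2 * PI * exp (ln 2 + 2 * d * ln r + 2 * r - / 2 * ln r))).
      * apply Rmult_le_compat_l. lra. apply mean_square_le_exp, Hr.
      * rewrite <- Rmult_assoc, (Rmult_comm (Rpower l (p - 2))), Rmult_assoc. apply Rmult_le_compat_l; [lra|].
        unfold Rpower, l. rewrite !ln_exp, <- exp_plus. apply exp_monotone.
        assert (Hln2 : 0 < ln 2) by (rewrite <- ln_1; apply ln_increasing; lra). nra.
    (* Replacing l by 2 l absorbs the factor 2, since 2 <= 2^p for p >= 1. *)
    + rewrite <- Rpower_mult_distr by lra.
      assert (H2 : 2 <= Rpower 2 p).
      { rewrite <- (Rpower_1 2) at 1 by lra. apply Rle_Rpower; lra. }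
      assert (H3 : 0 <= 2 * PI * Rpower l p) by (apply Rmult_le_pos; lra).
      assert (H4 := Rmult_le_compat_r _ _ _ H3 H2). lra.
Qed.

Lemma Mp_egf_le (p : Rbar) (r : R) : Rbar_le 1 p -> 0 < r ->
  Rbar_le (Mp p (egf a) r) (4 * exp r * Rpower r (d - growth_exponent p)).
Proof.
  intros Hp Hr. assert (He := exp_pos r). destruct p as [p | |].
  - simpl in Hp. unfold growth_exponent. destruct (Rle_dec p 2) as [H | H].
    + rewrite Rmax_left by lra. replace (1 / (2 * 2)) with (/ 4) by field.
      apply Mp_egf_le_le2; lra.
    + rewrite Rmax_right by lra. apply Mp_egf_le_ge2; lra.
  - simpl growth_exponent. rewrite Rminus_0_r.
    assert (H := exp_pos (d * ln r)). fold (Rpower r d) in H.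
    apply Mp_le_sup; try apply exp_bounded_coef; try lra; try exact I. nra.
    intros z Hz. apply Rle_trans with (1 := egf_sup_le z ltac:(lra)). rewrite Hz. nra.
  - destruct Hp.
Qed.

(** For r >= 1 the inequality d <= eps weakens the previous bound to the desired one. For r < 1 the
    exponents compare the other way, and r^K <= r^(eps - g) because K >= eps >= eps - g, where g is
    the growth exponent. *)
Lemma Mp_egf_growth (p : Rbar) (eps : R) (K : nat) : Rbar_le 1 p -> d <= eps <= INR K ->
  (forall k, (k < K)%nat -> a k = 0) -> forall r, 0 < r ->
  Rbar_le (Mp p (egf a) r) (4 * (exp r / Rpower r (growth_exponent p - eps))).
Proof.
  intros Hp Heps HK r Hr. assert (He := exp_pos r).
  assert (Hg : 0 <= growth_exponent p).
  { destruct p as [p | |]; simpl; try lra. assert (H := Rmax_l 2 p).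
    left; apply Rdiv_lt_0_compat; lra. }
  unfold Rdiv. rewrite <- Rpower_Ropp, <- Rmult_assoc.
  replace (- (growth_exponent p - eps)) with (eps - growth_exponent p) by ring.
  destruct (Rle_dec 1 r) as [H1 | H1].
  - apply Rbar_le_trans with (1 := Mp_egf_le p r Hp Hr). simpl.
    apply Rmult_le_compat_l; [lra|]. apply Rle_Rpower; lra.
  - assert (Hpow : 0 < r ^ K) by (apply pow_lt, Hr).
    apply Rbar_le_trans with (3 * r ^ K).
    + apply Mp_le_sup; try assumption; try lra. apply exp_bounded_coef.
      intros z Hz. rewrite <- Hz. apply egf_le_near_0. exact HK. lra.
    + simpl. rewrite <- (Rpower_pow K r Hr).
      assert (Hmono : Rpower r (INR K) <= Rpower r (eps - growth_exponent p)).
      { unfold Rpower. apply exp_monotone.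
        assert (Hln : ln r <= 0) by (rewrite <- ln_1; apply ln_le; lra). nra. }
      rewrite <- (Rpower_pow K r Hr) in Hpow. assert (H2 := exp_ineq1_le r). nra.
Qed.

End growth.

(** * Distributional irregularity *)

Lemma card_upto_le (A : nat -> Prop) (n : nat) : (card_upto A n <= n)%nat.
Proof.
  unfold card_upto. rewrite <- (length_seq n 1) at 2. apply filter_length_le.
Qed.

Lemma card_upto_ge (A : nat -> Prop) (m n : nat) : (1 <= m <= n)%nat ->
  (forall k, (m <= k <= n)%nat -> A k) -> (n - m <= card_upto A n)%nat.
Proof.
  intros Hm HA. unfold card_upto.
  replace n with ((m - 1) + (n - m + 1))%nat at 2 by lia.
  rewrite seq_app, filter_app, length_app.
  replace (1 + (m - 1))%nat with m by lia.
  rewrite (forallb_filter_id _ (seq m _)).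
  - rewrite length_seq. lia.
  - apply forallb_forall. intros k Hk. apply in_seq in Hk.
    destruct (excluded_middle_informative (A k)) as [_ | H]; [reflexivity|].
    exfalso. apply H, HA. lia.
Qed.

(** If A contains [m, m M], its proportion up to m M is at least 1 - 1/M, and M is arbitrary. *)
Lemma upper_density_1 (A : nat -> Prop) :
  (forall M, exists m, (1 <= m)%nat /\ forall k, (m <= k <= m * M)%nat -> A k) ->
  upper_density A = 1.
Proof.
  intros HA. apply is_LimSup_seq_unique. intros eps. split.
  - intros N. destruct (archimed_cor1 eps (cond_pos eps)) as [M0 [HM0 HM0']].
    (* M >= M0 makes 1/M smaller than [eps], and M >= N places m M beyond [N]. *)
    set (M := (M0 + N + 1)%nat).
    destruct (HA M) as [m [Hm HAm]]. exists (m * M)%nat. split.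
    + unfold M; nia.
    + assert (Hc := card_upto_ge A m (m * M) ltac:(unfold M; nia) HAm).
      apply le_INR in Hc. rewrite minus_INR in Hc by (unfold M; nia). rewrite mult_INR in Hc |- *.
      assert (Hm1 : 1 <= INR m) by (apply (le_INR 1); exact Hm).
      assert (HMM : 1 <= INR M) by (apply (le_INR 1); unfold M; lia).
      assert (HMi : / INR M < eps).
      { apply Rle_lt_trans with (2 := HM0). apply Rinv_le_contravar.
        apply lt_0_INR, HM0'. apply le_INR. unfold M; lia. }
      apply Rlt_le_trans with (1 - / INR M); [simpl; lra|].
      apply Rmult_le_reg_r with (INR m * INR M). nra.
      unfold Rdiv. rewrite (Rmult_assoc _ (/ _)), Rinv_l, Rmult_1_r by nra.
      replace ((1 - / INR M) * (INR m * INR M)) with (INR m * INR M - INR m) by (field; lra).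
      exact Hc.
  - exists 1%nat. intros n Hn. assert (He := cond_pos eps).
    apply Rle_lt_trans with 1; [|simpl; lra].
    assert (Hn1 : 1 <= INR n) by (apply (le_INR 1); exact Hn).
    apply Rmult_le_reg_r with (INR n); [lra|].
    unfold Rdiv. rewrite Rmult_assoc, Rinv_l, Rmult_1_r, Rmult_1_l by lra.
    apply le_INR, card_upto_le.
Qed.

Lemma open_Cmod_lt (r : R) : @open C_UniformSpace (fun z => Cmod z < r).
Proof.
  assert (Htri : forall y z : C, Cmod y <= Cmod (y - z)%C + Cmod z).
  { intros y z. replace y with (y - z + z)%C at 1 by ring. apply Cmod_triangle. }
  intros z Hz. apply locally_C.
  assert (Hd : 0 < r - Cmod z) by lra.
  exists (mkposreal _ Hd). intros y Hy. change (Cmod (y - z)%C < r - Cmod z) in Hy.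
  assert (H := Htri y z). lra.
Qed.

(** Cover K by the open discs of integer radius; the largest radius of a finite subcover is a
    bound. *)
Lemma compact_C_bounded (K : C -> Prop) : compact_C K ->
  exists r, 0 <= r /\ forall z, K z -> Cmod z <= r.
Proof.
  intros HK. destruct (HK nat (fun n z => Cmod z < INR n)) as [l Hl].
  - intros n. apply open_Cmod_lt.
  - intros z _. destruct (INR_unbounded (Cmod z)) as [n Hn]. exists n. exact Hn.
  - exists (INR (list_max l)). split. apply pos_INR.
    intros z Hz. destruct (Hl z Hz) as [n [Hn Hzn]]. left. apply Rlt_le_trans with (1 := Hzn).
    apply le_INR. assert (H := proj1 (list_max_le l (list_max l)) (le_n _)).
    rewrite Forall_forall in H. apply H, Hn.
Qed.

Lemma sup_norm_ge (K : C -> Prop) (g : C -> C) (z : C) : K z -> Rbar_le (Cmod (g z)) (sup_norm K g).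
Proof. intros Hz. apply Lub_Rbar_correct. exists z. split; [exact Hz | reflexivity]. Qed.

(* For [k >= 2], [log2 (log2 k) = i] exactly when [2^(2^i) <= k < 2^(2^(i+1))]; [Nat.log2 0 = 0]. *)
Definition in_support (K k : nat) : bool := (K <=? k)%nat && Nat.even (Nat.log2 (Nat.log2 k)).

Definition coef (d : R) (K k : nat) : R := if in_support K k then Rpower (INR k) d else 0.

Lemma log2_log2_block (i k : nat) :
  (2 ^ 2 ^ i <= k < 2 ^ 2 ^ i * 2 ^ 2 ^ i)%nat -> Nat.log2 (Nat.log2 k) = i.
Proof.
  intros [H1 H2]. assert (Hk : (0 < k)%nat).
  { assert (H := Nat.pow_nonzero 2 (2 ^ i) ltac:(lia)). lia. }
  apply (Nat.log2_le_pow2 k _ Hk) in H1.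
  rewrite <- Nat.pow_add_r in H2. apply (Nat.log2_lt_pow2 k _ Hk) in H2.
  apply Nat.log2_unique; [lia|]. rewrite Nat.pow_succ_r by lia. lia.
Qed.

Lemma le_pow2_pow2 (i : nat) : (i < 2 ^ 2 ^ i)%nat.
Proof.
  assert (H1 := Nat.pow_gt_lin_r 2 i ltac:(lia)).
  assert (H2 := Nat.pow_gt_lin_r 2 (2 ^ i) ltac:(lia)). lia.
Qed.

Lemma upper_density_support (K : nat) :
  upper_density (fun n => (1 <= n)%nat /\ in_support K n = true) = 1.
Proof.
  (* An even index, so that the block is kept; m > i gives m >= K and m M < m^2. *)
  apply upper_density_1. intros M. set (i := (2 * (K + M))%nat).
  assert (Hi := le_pow2_pow2 i). set (m := (2 ^ 2 ^ i)%nat) in *.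
  exists m. split; [lia|]. intros k Hk. split; [lia|].
  unfold in_support. rewrite (log2_log2_block i k).
  - apply andb_true_intro. split. apply Nat.leb_le. lia.
    unfold i. rewrite Nat.even_mul. reflexivity.
  - fold m. nia.
Qed.

Lemma upper_density_gap (K : nat) :
  upper_density (fun n => (1 <= n)%nat /\ forall k, (n <= k < 2 * n)%nat -> in_support K k = false) = 1.
Proof.
  (* An odd index, so that the block is omitted; m > 2 M gives 2 n <= 2 m M < m^2, and [n, 2n) stays
     inside the block. *)
  apply upper_density_1. intros M. set (i := (2 * M + 1)%nat).
  assert (Hi := le_pow2_pow2 i). set (m := (2 ^ 2 ^ i)%nat) in *.
  exists m. split; [lia|]. intros n Hn. split; [lia|]. intros k Hk.
  unfold in_support. rewrite (log2_log2_block i k).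
  - apply andb_false_intro2. unfold i. rewrite Nat.even_add, Nat.even_mul. reflexivity.
  - fold m. nia.
Qed.

(** From n = 3 on, (n + 1)^2 <= 2 n^2, which is the induction step; the factor 2 on the right covers
    n = 3, where n^2 exceeds 2^n. *)
Lemma sqr_le_pow2 (n : nat) : INR n * INR n <= 2 * 2 ^ n.
Proof.
  assert (H : forall k, INR (k + 3) * INR (k + 3) <= 2 * 2 ^ (k + 3)).
  { induction k as [|k IH]. simpl; lra.
    change (S k + 3)%nat with (S (k + 3)). rewrite S_INR. simpl pow.
    assert (H3 : 3 <= INR (k + 3)) by (rewrite plus_INR; assert (H := pos_INR k); simpl; lra). nra. }
  destruct n as [|[|[|n]]]; try (simpl; lra).
  replace (S (S (S n))) with (n + 3)%nat by lia. apply H.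
Qed.

(** * Iterated derivatives along the gaps and along the support *)

(** The shifted coefficients satisfy a_(n+k) <= n 2^(-n) 4^k: they vanish for k < n, and for k >= n
    one has n + k <= n 2^k and 2^n 2^k <= 4^k. Summing gives the exponential at 4 r. *)
Lemma Cmod_Dn_gap_le (a : nat -> R) (n : nat) (r : R) (z : C) :
  exp_bounded a -> (forall k, 0 <= a k <= INR k) -> (1 <= n)%nat ->
  (forall k, (n <= k < 2 * n)%nat -> a k = 0) -> Cmod z <= r ->
  Cmod (Dn n (egf a) z) <= INR n / 2 ^ n * exp (4 * r).
Proof.
  intros Ha Hle Hn Hgap Hz. rewrite (Dn_egf a n Ha).
  apply Rle_trans with (1 := Cmod_egf_le _ z (exp_bounded_shift a n Ha)).
  assert (H0 := Cmod_ge_0 z).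
  assert (Hs := is_series_scal (INR n / 2 ^ n) _ _ (is_series_exp (4 * r))).
  rewrite <- (is_series_unique _ _ Hs : Series _ = INR n / 2 ^ n * exp (4 * r)).
  apply Series_le; [|eexists; exact Hs]. intros k.
  assert (Hf := Rinv_0_lt_compat _ (INR_fact_pos k)). assert (Hp := pow_le _ k H0).
  rewrite Rabs_pos_eq by apply Hle. split.
  - apply Rmult_le_pos; [|lra]. apply Rmult_le_pos; [apply Hle | exact Hp].
  - change (a (n + k)%nat * Cmod z ^ k * / INR (fact k)
      <= INR n / 2 ^ n * ((4 * r) ^ k * / INR (fact k))).
    rewrite <- Rmult_assoc. apply Rmult_le_compat_r; [lra|].
    rewrite Rpow_mult_distr, <- Rmult_assoc.
    apply Rmult_le_compat; [apply Hle | exact Hp | | apply pow_incr; lra].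
    assert (Hn1 : 1 <= INR n) by (apply (le_INR 1); exact Hn).
    destruct (Nat.lt_ge_cases k n) as [Hk | Hk].
    + rewrite Hgap by lia. apply Rmult_le_pos; [|apply pow_le; lra].
      left; apply Rdiv_lt_0_compat; [lra | apply pow_lt; lra].
    + apply Rle_trans with (1 := proj2 (Hle _)). rewrite plus_INR.
      assert (Hk1 := INR_succ_le_pow2 k).
      apply Rle_trans with (INR n * 2 ^ k).
      * assert (H1 := pos_INR k). nra.
      * replace (4 ^ k) with (2 ^ n * (2 ^ (k - n) * 2 ^ k)).
        2: { rewrite <- !pow_add. replace 4 with (2 * 2) by ring.
             rewrite Rpow_mult_distr, <- pow_add. f_equal. lia. }
        replace (INR n / 2 ^ n * (2 ^ n * (2 ^ (k - n) * 2 ^ k)))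
          with (INR n * 2 ^ k * 2 ^ (k - n)) by (field; apply pow_nonzero; lra).
        assert (H1 := pow_R1_Rle 2 (k - n) ltac:(lra)).
        assert (H2 : 0 <= INR n * 2 ^ k) by (apply Rmult_le_pos; [lra | apply pow_le; lra]). nra.
Qed.

Lemma Dn_converges_along_gaps (a : nat -> R) (A : nat -> Prop) :
  exp_bounded a -> (forall k, 0 <= a k <= INR k) ->
  (forall n, A n -> (1 <= n)%nat /\ forall k, (n <= k < 2 * n)%nat -> a k = 0) ->
  converges_HC_along A (fun n => Dn n (egf a)) (fun _ => 0%C).
Proof.
  intros Ha Hle HA K HK eps. destruct (compact_C_bounded K HK) as [r [Hr HKr]].
  (* The threshold comes from n / 2^n <= 2 / n, a form of [sqr_le_pow2]. *)
  destruct (INR_unbounded (2 * exp (4 * r) / eps)) as [N HN].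
  exists N. intros n Hn HAn z Hz. destruct (HA n HAn) as [Hn1 Hgap].
  replace (Dn n (egf a) z - 0)%C with (Dn n (egf a) z) by ring.
  apply Rle_lt_trans with (1 := Cmod_Dn_gap_le a n r z Ha Hle Hn1 Hgap (HKr z Hz)).
  assert (He := cond_pos eps). assert (Hx := exp_pos (4 * r)).
  assert (HnN : INR N <= INR n) by (apply le_INR; exact Hn).
  assert (Hpos : 0 < INR n) by (apply lt_0_INR; lia).
  assert (H1 : 2 * exp (4 * r) < INR n * eps).
  { apply Rmult_lt_reg_r with (/ eps). apply Rinv_0_lt_compat, He.
    rewrite (Rmult_assoc (INR n)), Rinv_r, Rmult_1_r by lra. unfold Rdiv in HN. lra. }
  assert (H2 := sqr_le_pow2 n). assert (Hp : 0 < 2 ^ n) by (apply pow_lt; lra).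
  assert (H3 : INR n / 2 ^ n <= 2 / INR n).
  { apply Rmult_le_reg_r with (2 ^ n * INR n). nra.
    replace (INR n / 2 ^ n * (2 ^ n * INR n)) with (INR n * INR n) by (field; lra).
    replace (2 / INR n * (2 ^ n * INR n)) with (2 * 2 ^ n) by (field; lra). exact H2. }
  apply Rle_lt_trans with (2 / INR n * exp (4 * r)).
  - apply Rmult_le_compat_r; lra.
  - apply Rmult_lt_reg_r with (INR n). exact Hpos.
    replace (2 / INR n * exp (4 * r) * INR n) with (2 * exp (4 * r)) by (field; lra). lra.
Qed.

Lemma Dn_unbounded_along (a : nat -> R) (B : nat -> Prop) (d : R) : 0 < d -> exp_bounded a ->
  (forall n, B n -> Rpower (INR n) d <= a n) ->
  tends_to_infinity_along B (fun n => sup_norm (closed_disc (INR 1)) (Dn n (egf a))).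
Proof.
  intros Hd Ha HB M. assert (HM := Rabs_pos M).
  (* The threshold is (|M| + 1)^(1/d), beyond which n^d exceeds |M| + 1; the added 1 keeps the
     logarithm meaningful when M = 0. *)
  destruct (INR_unbounded (exp (ln (Rabs M + 1) / d))) as [N HN].
  exists N. intros n Hn HBn.
  apply Rbar_lt_le_trans with (Cmod (Dn n (egf a) 0%C)).
  2: { apply (sup_norm_ge (closed_disc (INR 1))). unfold closed_disc. rewrite Cmod_0. simpl; lra. }
  rewrite (Dn_egf a n Ha), (egf_0 _ (exp_bounded_shift a n Ha)), Cmod_R, Nat.add_0_r.
  apply Rlt_le_trans with (2 := Rle_trans _ _ _ (HB n HBn) (Rle_abs _)).
  apply Rle_lt_trans with (1 := Rle_abs M). apply Rlt_trans with (Rabs M + 1); [lra|].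
  rewrite <- (exp_ln (Rabs M + 1)) by lra. unfold Rpower. apply exp_increasing.
  assert (HnN : INR N <= INR n) by (apply le_INR; exact Hn).
  assert (H1 : ln (Rabs M + 1) / d < ln (INR n)).
  { rewrite <- (ln_exp (ln (Rabs M + 1) / d)). apply ln_increasing. apply exp_pos. lra. }
  apply Rmult_lt_compat_l with (r := d) in H1; [|exact Hd].
  replace (d * (ln (Rabs M + 1) / d)) with (ln (Rabs M + 1)) in H1 by (field; lra). exact H1.
Qed.

Theorem theorem11 :
  forall p : Rbar, Rbar_le 1 p ->
  forall eps : R, 0 < eps ->
  exists f : C -> C,
    distributionally_irregular f /\
    exists c : R, 0 < c /\
      forall r : R, 0 < r ->
        Rbar_le (Mp p f r) (c * (exp r / Rpower r (growth_exponent p - eps))).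
Proof.
  intros p Hp eps Heps.
  set (d := Rmin eps (/ 2)).
  assert (Hd : 0 < d <= / 2).
  { split. apply Rmin_pos; lra. apply Rmin_r. }
  assert (Hde : d <= eps) by apply Rmin_l.
  destruct (INR_unbounded eps) as [K HK].
  (* This keeps the index 0, where [Rpower] would give 1, out of the support. *)
  assert (HK1 : (1 <= K)%nat) by (destruct K; [simpl in HK; lra | lia]).
  assert (Hsmall : forall k, (k < K)%nat -> coef d K k = 0).
  { intros k Hk. unfold coef, in_support. apply Nat.leb_gt in Hk. rewrite Hk. reflexivity. }
  assert (Hpos : forall k, 0 <= coef d K k).
  { intros k. unfold coef. destruct (in_support K k); [left; apply exp_pos | lra]. }
  assert (Hle : forall k, (1 <= k)%nat -> coef d K k <= Rpower (INR k) d).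
  { intros k _. unfold coef. destruct (in_support K k); [lra | left; apply exp_pos]. }
  assert (Ha0 : coef d K 0 = 0) by (apply Hsmall; lia).
  assert (Hd' : 0 <= d <= / 2) by lra.
  assert (Ha := exp_bounded_coef _ d Hd' Ha0 Hpos Hle).
  exists (egf (coef d K)). split.
  - split. apply entire_egf, Ha.
    exists 1%nat.
    exists (fun n => (1 <= n)%nat /\ forall k, (n <= k < 2 * n)%nat -> in_support K k = false).
    exists (fun n => (1 <= n)%nat /\ in_support K n = true).
    split; [lia|]. split; [tauto|]. split; [tauto|].
    split; [apply upper_density_gap|]. split; [apply upper_density_support|]. split.
    + apply Dn_converges_along_gaps. exact Ha.
      intros k. split. apply Hpos. apply (coef_le_INR _ d); assumption.
      intros n [Hn Hgap]. split. exact Hn.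
      intros k Hk. unfold coef. rewrite Hgap by exact Hk. reflexivity.
    + apply (Dn_unbounded_along _ _ d); [lra | exact Ha |].
      intros n [_ Hn]. unfold coef. rewrite Hn. lra.
  - exists 4. split; [lra|].
    apply (Mp_egf_growth _ d Hd' Ha0 Hpos Hle p eps K Hp); [lra | exact Hsmall].
Qed.
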